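(* There exists a constant $c>0$ such that for any function $p=p(n)$ with values in $[0,1]$, the random graph $G(n,p)$ asymptotically almost surely can be decomposed into at most $cn$ cycles and edges.
   Context: Graphs are finite and simple. $G(n,p)$ is the random graph on vertex set $\{1,\dots,n\}$ in which each potential edge is included independently with probability $p$. A property holds asymptotically almost surely if the probability that $G(n,p)$ has it tends to $1$ as $n\to\infty$. A decomposition of a graph into cycles and edges is a partition of its edge set into sets each of which is either the edge set of a cycle or a single edge. *)

(* Defs.v *)
From mathcomp Require Import all_boot all_order all_algebra.
From mathcomp Require Import boolp classical_sets reals topology normedtype.
From mathcomp Require Import sequences.

Set Implicit Arguments.
Unset Strict Implicit.
Unset Printing Implicit Defensive.

Import Order.TTheory GRing.Theory Num.Theory.
Import numFieldNormedType.Exports.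

Local Open Scope ring_scope.

(* A simple graph on the vertex set T is given by its edge set, a set of
   two-element subsets of T. *)
Definition potential_edges (T : finType) : {set {set T}} :=
  [set e : {set T} | #|e| == 2]%SET.

Definition simple_graphs (T : finType) : {set {set {set T}}} :=
  powerset (potential_edges T).

(* The edges of the cycle through the distinct vertices of s, in that order;
   next s x is the cyclic successor, so the closing edge is included. *)
Definition cycle_edges (T : finType) (s : seq T) : {set {set T}} :=
  [set [set x; next s x] | x in s]%SET.

Definition is_cycle (T : finType) (C : {set {set T}}) : Prop :=
  exists s : seq T, [/\ uniq s, (3 <= size s)%N & C = cycle_edges s].

Definition is_single_edge (T : finType) (C : {set {set T}}) : Prop :=
  exists2 e : {set T}, e \in potential_edges T & C = [set e]%SET.

Definition cycle_edge_decomposition (T : finType) (E : {set {set T}})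
    (D : {set {set {set T}}}) : Prop :=
  finset.partition D E /\ forall C, C \in D -> is_cycle C \/ is_single_edge C.

Definition gnp_weight (R : realType) (n : nat) (p : R)
    (E : {set {set 'I_n}}) : R :=
  \prod_(e in potential_edges 'I_n) (if e \in E then p else 1 - p).

Definition gnp_prob (R : realType) (n : nat) (p : R)
    (A : {set {set 'I_n}} -> Prop) : R :=
  \sum_(E in simple_graphs 'I_n | `[< A E >]) gnp_weight p E.

Definition asymptotically_almost_surely (R : realType) (p : nat -> R)
    (A : forall n : nat, {set {set 'I_n}} -> Prop) : Prop :=
  (gnp_prob (p n) (@A n) @[n --> \oo] --> (1 : R))%classic.

(* Main.v *)
Require Import Defs.
From mathcomp Require Import all_boot all_order all_algebra.
From mathcomp Require Import boolp classical_sets reals topology normedtype.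
From mathcomp Require Import sequences.
From mathcomp Require Import fintype finset zify ring lra.

(** Reserve a sparse random subgraph S of G(n, p), with edge density about
    n^(-1/4), and use it to close up a decomposition of everything else into
    few paths. Three facts make this work.

    Any graph on n vertices is a union of at most n edges and of n paths such
    that every vertex is exactly twice the end of a path, a trivial path
    counting as two ends at its vertex (path_decomposition). Cycles are removed
    while there are more than n edges, and are then added back to the system of
    trivial paths, edge by edge along the cycle. Adding an edge vx moves one
    path end from x to v, by the rerouting argument of Lovasz (move_end), so
    that a full turn around the cycle leaves the numbers of ends unchanged.

    If any two vertices have common neighbours in S outside the part of the
    graph where the paths live, then each path from u to w is closed to a cycle
    by a common neighbour a of u and w (close_paths). An edge ua used in this
    way belongs to its end u, so that two paths can only compete for it if they
    share an end, and since every vertex is an end only twice, a greedy choice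
    among five candidates avoids all conflicts. To keep paths away from the
    connecting vertices, the vertices are coloured by the points of the Fano
    plane, with one line attached to each point: the edges of G outside S are
    sorted by a line containing the colours of both ends, and are closed through
    the point attached to that line. Two of these seven families never want the
    same edge of S (reservoir_decomposition).

    What is left of S is an unknown subgraph, and it has to be decomposed
    whatever it is. In G(n, q) with q about n^(-1/4), no vertex set of size k
    spans more than k (K + k / M) edges, where K is a constant and M a
    small power of n (gnp_prob_not_locally_sparse). In a subgraph of minimum
    degree d this forces the vertex sets of size about M d to expand, hence a
    cycle of length proportional to M d (locally_sparse_long_cycle). Halving the
    number of edges therefore costs O(n / M) cycles, and after O(log n) halvings
    only O(n) edges are left (locally_sparse_decomposition).

    If p is too small for the reserve to exist, then G(n, p) is itself locally
    sparse and the last fact applies to all of it. Otherwise the reserve is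
    obtained by thinning G(n, p) (gnp_prob_thin). As the closing step asks for
    common neighbours of all pairs of vertices, nothing has to be known about
    the dependence between S and the paths. *)

Set Implicit Arguments.
Unset Strict Implicit.
Unset Printing Implicit Defensive.

(** * Long cycles in expanding graphs *)

Definition outer_boundary (T : finType) (e : rel T) (S : {set T}) : {set T} :=
  [set y | (y \notin S) && [exists x in S, e x y]].

(** This is depth-first search, phrased as an invariant: r is the stack, a path
    all of whose outside contacts with the unvisited set W go through r, and
    every vertex of W can be reached from the top of r inside W. Take a
    smallest set S of at least s vertices that is closed in W. If it has fewer
    than 2s vertices, its boundary lies on r and has at least l vertices, so the
    lowest of them closes a cycle that contains all the others. If it is larger,
    minimality makes it connected, and the search enters it by a vertex
    adjacent to the top of r. *)
Lemma long_cycle_from_stack (T : finType) (e : rel T) (s l : nat)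
    (W : {set T}) (r : seq T) :
  symmetric e -> 0 < s -> 0 < l -> s <= #|W| ->
  sorted e r -> uniq r -> {in W, forall x, x \notin r} ->
  {in W, forall x y, e x y -> (y \in W) || (y \in r)} ->
  (forall z r', r = rcons r' z -> {in W, forall x,
     exists p, [/\ path e z p, last z p = x, {subset p <= W} & uniq p]}) ->
  (forall S : {set T}, S \subset W -> s <= #|S| < s.*2 ->
     l <= #|outer_boundary e S|) ->
  exists c, [/\ uniq c, cycle e c & l < size c].
Proof.
move=> e_sym s_gt0 l_gt0; have [N] := ubnP #|W|.
elim: N W r => // N IHN W r; rewrite ltnS => leWN sW r_path r_uniq Wr Wcl Wreach Wexp.
pose closedW (S : {set T}) :=
  [&& S \subset W, [forall x in S, forall y in W, e x y ==> (y \in S)] & s <= #|S|].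
have clP S x y : closedW S -> x \in S -> y \in W -> e x y -> y \in S.
  by move=> /and3P[_ /forall_inP/(_ x) clS _] xS yW exy;
     move: (clS xS) => /forall_inP/(_ y yW)/implyP/(_ exy).
have clW : closedW W.
  apply/and3P; split=> //; apply/forall_inP=> x _; apply/forall_inP=> y yW.
  exact/implyP.
case: (@arg_minnP _ W closedW (fun S => #|S|) clW) => S clS Smin.
have /and3P[SW _ sS] := clS.
have [Slt|Sge] := ltnP #|S| s.*2.
- have Nb_r : {subset outer_boundary e S <= r}.
    move=> y; rewrite inE => /andP[yS /exists_inP[x xS exy]].
    have /orP[yW|//] := Wcl x (subsetP SW _ xS) y exy.
    by rewrite (clP S x y) in yS.
  have lN := Wexp S SW (introT andP (conj sS Slt)).
  have has_r : has (mem (outer_boundary e S)) r.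
    have /card_gt0P[y yN] := leq_trans l_gt0 lN.
    by apply/hasP; exists y => //; exact: Nb_r.
  (* y is the first vertex of the stack that lies on the boundary of S. *)
  case: (split_find has_r) r_path r_uniq Wr Nb_r Wreach => y r1 r2 yN r1N.
  move=> r_path r_uniq Wr Nb_r Wreach.
  move: (yN); rewrite /= inE => /andP[yS /exists_inP[x xS exy]].
  have xW := subsetP SW _ xS.
  have [r' rE] : exists r', rcons r1 y ++ r2 = rcons r' (last y r2).
    case/lastP: (r2) => [|r2' z]; first by exists r1; rewrite cats0.
    by exists (rcons r1 y ++ r2'); rewrite last_rcons rcons_cat.
  have [p [p_path p_last pW p_uniq]] := Wreach _ _ rE x xW.
  exists ((y :: r2) ++ p); split.
  + rewrite cat_uniq p_uniq andbT.
    move: r_uniq; rewrite -cats1 -catA cat_uniq => /and3P[_ _ r2_uniq].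
    rewrite -[_ :: _]/([:: y] ++ r2) r2_uniq /=.
    apply/hasPn => z /pW zW; apply: contra (Wr z zW) => zr.
    by rewrite -cats1 -catA mem_cat zr orbT.
  + rewrite /cycle /= rcons_path cat_path last_cat p_path p_last exy !andbT.
    move: r_path; rewrite -cats1 -catA; case: (r1) => [//|a r1'] /=.
    by rewrite cat_path /= => /and3P[].
  + have szp : 0 < size p.
      case: p p_last {p_path pW p_uniq} => //= xl.
      by case/negP: (Wr x xW); rewrite -xl rE mem_rcons inE eqxx.
    suff le_l : l <= size (y :: r2) by rewrite size_cat -addn1 leq_add.
    apply: leq_trans lN _; apply: leq_trans (card_size (y :: r2)).
    apply: subset_leq_card; apply/subsetP => z zN.
    have := Nb_r z zN; rewrite -cats1 -catA mem_cat => /orP[zr1|//].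
    by case/hasP: r1N; exists z.
- have [u [uS u_r]] : exists u, u \in S /\ (forall z r', r = rcons r' z -> e z u).
    have /card_gt0P[x xS] : 0 < #|S| by apply: leq_trans sS.
    case/lastP: r {r_path r_uniq Wcl} Wr Wreach => [|r' z] Wr Wreach.
      by exists x; split=> // z []//.
    have [p [p_path p_last pW _]] := Wreach z r' erefl x (subsetP SW _ xS).
    case: p p_path p_last pW => [_ zx _|u p /= /andP[ezu u_path] p_last pW].
      case/negP: (Wr x (subsetP SW _ xS)).
      by rewrite -zx mem_rcons inE eqxx.
    exists u; split=> [|z' r'' /eqP]; last by rewrite eqseq_rcons => /andP[_ /eqP <-].
    have: last u p \in S by rewrite p_last.
    elim: p u u_path {p_last ezu} pW => //= a p IHp u /andP[eua a_path] pW lastS.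
    have aS : a \in S.
      by apply: IHp => // b bp; apply: pW; rewrite in_cons bp orbT.
    by apply: (clP S a u) => //; [apply: pW; rewrite in_cons eqxx | rewrite e_sym].
  pose eS x y := [&& x \in S, y \in S & e x y].
  have pathS v q : path eS v q -> all [in S] q.
    by elim: q v => //= b q IHq v /andP[/and3P[_ -> _] /IHq ->].
  pose C := [set x in S | connect eS u x].
  have CS : C \subset S by apply/subsetP => x; rewrite inE => /andP[].
  have eS_sym : connect_sym eS.
    by apply: sym_connect_sym => x y; rewrite /eS e_sym andbCA.
  have Cstep x y : x \in S -> y \in W -> e x y -> (x \in C) = (y \in C).
    move=> xS yW exy; have yS := clP S x y clS xS yW exy.
    rewrite !inE xS yS /=; apply/idP/idP => /connect_trans; apply; apply: connect1.
      by rewrite /eS xS yS.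
    by rewrite /eS xS yS e_sym.
  have SC : S \subset C.
    have [sC|Cs] := leqP s #|C|.
      have clC : closedW C.
        rewrite /closedW (subset_trans CS SW) sC andbT.
        apply/forall_inP => x xC; apply/forall_inP => y yW; apply/implyP => exy.
        by rewrite -(Cstep x y) // (subsetP CS).
      by rewrite -(geq_leqif (subset_leqif_card CS)) Smin.
    have clD : closedW (S :\: C).
      apply/and3P; split; first by rewrite subDset subsetU // SW orbT.
        apply/forall_inP => x; rewrite inE => /andP[xC xS].
        apply/forall_inP => y yW; apply/implyP => exy.
        by rewrite inE -(Cstep x y) // xC (clP S x y).
      by rewrite cardsD (setIidPr CS); clear - Sge Cs; lia.
    have uC : u \in C by rewrite inE uS connect0.
    have := Smin _ clD; rewrite cardsD (setIidPr CS).
    have : 0 < #|C| by apply/card_gt0P; exists u.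
    by move: (subset_leq_card CS); clear; lia.
  have uW := subsetP SW u uS.
  have cardSu : #|S :\ u| = #|S|.-1 by rewrite (cardsD1 u S) uS.
  have SuW : S :\ u \subset W by rewrite subDset subsetU // SW orbT.
  apply: (IHN (S :\ u) (rcons r u)).
  + rewrite cardSu; move: (subset_leq_card SW) (leq_trans s_gt0 sS).
    by clear - leWN; lia.
  + by rewrite cardSu; clear - Sge s_gt0; lia.
  + case/lastP: r r_path u_r {r_uniq Wr Wcl Wreach} => //= r z r_path u_r.
    case: r r_path u_r => [_ u_r|a r] /=; first by rewrite (u_r _ [::]).
    rewrite !rcons_path last_rcons => -> u_r /=.
    by rewrite (u_r _ (a :: r)).
  + by rewrite rcons_uniq r_uniq Wr.
  + move=> x /setD1P[xu xS]; rewrite mem_rcons inE negb_or xu /=.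
    by rewrite Wr // (subsetP SW).
  + move=> x /setD1P[xu xS] y exy; rewrite mem_rcons !inE.
    have /orP[yW|->] := Wcl x (subsetP SW _ xS) y exy; last by rewrite !orbT.
    by rewrite (clP S x y) //; case: eqP.
  + move=> z r' /eqP; rewrite eqseq_rcons => /andP[_ /eqP <-] x /setD1P[xu xS].
    have /setIdP[_ /connectP[p p_path ->]] := subsetP SC x xS.
    case/shortenP: p_path => p' p'_path /= /andP[up' p'_uniq] _.
    exists p'; split=> //.
      by apply: sub_path p'_path => a b /and3P[].
    move=> a ap'; rewrite !inE; apply/andP; split.
      by apply: contraNneq up' => <-.
    by have /allP := pathS _ _ p'_path; apply.
  + by move=> S' /subset_trans/(_ SuW); exact: Wexp.
Qed.

(** * Decompositions and subgraphs of large minimum degree *)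

Definition decomposable_into (T : finType) (k : nat) (E : {set {set T}}) : Prop :=
  exists2 D, cycle_edge_decomposition E D & #|D| <= k.

Lemma decomposable_leq (T : finType) j k (E : {set {set T}}) :
  j <= k -> decomposable_into j E -> decomposable_into k E.
Proof. by move=> le_jk [D ED /leq_trans/(_ le_jk)]; exists D. Qed.

Lemma decomposable0 (T : finType) k : decomposable_into k (set0 : {set {set T}}).
Proof.
exists set0; last by rewrite cards0.
split; last by move=> C; rewrite inE.
apply/and3P; split; [by rewrite /cover big_set0 | | by rewrite inE].
by apply/trivIsetP => A B; rewrite inE.
Qed.

Lemma decomposableU (T : finType) j k (E1 E2 : {set {set T}}) :
  [disjoint E1 & E2] -> decomposable_into j E1 -> decomposable_into k E2 ->
  decomposable_into (j + k) (E1 :|: E2).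
Proof.
move=> dis [D1 [/and3P[/eqP cov1 tr1 no1] DC1] le1].
move=> [D2 [/and3P[/eqP cov2 tr2 no2] DC2] le2].
exists (D1 :|: D2); last first.
  by apply: leq_trans (leq_card_setU D1 D2) _; exact: leq_add.
split; last by move=> C; rewrite inE => /orP[/DC1|/DC2].
apply/and3P; split; last by rewrite inE negb_or no1 no2.
  by rewrite /cover bigcup_setU -/(cover D1) -/(cover D2) cov1 cov2.
apply/trivIsetP => A B.
have sub1 A' : A' \in D1 -> A' \subset E1 by rewrite -cov1; exact: bigcup_sup.
have sub2 A' : A' \in D2 -> A' \subset E2 by rewrite -cov2; exact: bigcup_sup.
rewrite !inE => /orP[A1|A2] /orP[B1|B2] AB.
- by move/trivIsetP: tr1; apply.
- exact: disjointW (sub1 _ A1) (sub2 _ B2) dis.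
- rewrite disjoint_sym.
  exact: disjointW (sub1 _ B1) (sub2 _ A2) dis.
- by move/trivIsetP: tr2; apply.
Qed.

Lemma decomposable1 (T : finType) (C : {set {set T}}) :
  C != set0 -> is_cycle C \/ is_single_edge C -> decomposable_into 1 C.
Proof.
move=> C0 CP; exists [set C]; last by rewrite cards1.
split; last by move=> C' /set1P ->.
apply/and3P; split; first by rewrite /cover big_set1.
  by rewrite /trivIset /cover !big_set1.
by rewrite inE eq_sym.
Qed.

Lemma decomposable_edges (T : finType) (E : {set {set T}}) :
  E \subset potential_edges T -> decomposable_into #|E| E.
Proof.
have [n] := ubnP #|E|; elim: n E => // n IHn E ltE Epot.
have [->|[f fE]] := set_0Vmem E; first exact: decomposable0.
rewrite -(setD1K fE) cardsU1 !inE eqxx /=; apply: decomposableU.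
- by rewrite disjoints1 !inE eqxx.
- apply: decomposable1; first by apply/set0Pn; exists f; rewrite inE.
  by right; exists f => //; exact: subsetP Epot _ fE.
- apply: IHn; last exact: subset_trans (subsetDl _ _) Epot.
  by move: ltE; rewrite (cardsD1 f) fE.
Qed.

Lemma set2_inj (T : finType) (x : T) : injective (fun y => [set x; y]).
Proof.
move=> y z eq_xyz; have := set22 x y; rewrite eq_xyz !inE => /orP[/eqP yx|/eqP //].
by have := set22 x z; rewrite -eq_xyz yx !inE orbb => /eqP.
Qed.

Lemma card_edge (T : finType) (E : {set {set T}}) f :
  E \subset potential_edges T -> f \in E -> #|f| = 2.
Proof. by move=> /subsetP sub /sub; rewrite inE => /eqP. Qed.

Lemma potential_edge_neq (T : finType) (x y : T) :
  ([set x; y] \in potential_edges T) = (x != y).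
Proof. by rewrite inE cards2; case: (x == y). Qed.

Section NextCycle.

Variables (T : finType) (c : seq T).
Hypotheses (c_uniq : uniq c) (c_gt2 : 2 < size c).

Lemma next_next_neq x : x \in c -> next c (next c x) != x.
Proof.
case/rot_to => i s rot_c.
have s_uniq : uniq (x :: s) by rewrite -rot_c rot_uniq.
have : 2 < size (x :: s) by rewrite -rot_c size_rot.
rewrite -!(next_rot i c_uniq) rot_c.
case: s s_uniq {rot_c} => [|a [|b s]] //= /and4P[].
rewrite !inE !negb_or => /and3P[xa xb _] /andP[ab _] _ _ _.
by rewrite eqxx [a == x]eq_sym (negbTE xa) eqxx eq_sym.
Qed.

Lemma card_cycle_edges : #|cycle_edges c| = size c.
Proof.
rewrite card_in_imset; first exact/card_uniqP.
move=> x y xc yc; have [//|xy] := eqVneq x y; move=> eq_xy.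
have := set21 x (next c x); rewrite eq_xy !inE (negbTE xy) /= => /eqP x_ny.
have := set21 y (next c y); rewrite -eq_xy !inE eq_sym (negbTE xy) /= => /eqP y_nx.
by case/negP: (next_next_neq xc); rewrite -y_nx -x_ny.
Qed.

End NextCycle.

Definition adjacent_in (T : finType) (E : {set {set T}}) (C : {set T}) : rel T :=
  fun x y => [&& x \in C, y \in C & [set x; y] \in E].

Definition edges_in (T : finType) (E : {set {set T}}) (S : {set T}) : {set {set T}} :=
  [set f in E | f \subset S].

Lemma adjacent_in_sym (T : finType) E (C : {set T}) : symmetric (adjacent_in E C).
Proof. by move=> x y; rewrite /adjacent_in andbCA setUC. Qed.

Lemma cycle_edges_sub (T : finType) (E : {set {set T}}) (C : {set T}) c :
  cycle (adjacent_in E C) c -> cycle_edges c \subset E.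
Proof.
move=> c_cycle; apply/subsetP => f /imsetP[x xc ->].
by have /and3P[] := next_cycle c_cycle xc.
Qed.

(** A smallest vertex set C spanning more than d #|C| edges works: deleting a
    vertex of degree at most d would leave a smaller such set. *)
Lemma min_degree_subgraph (T : finType) (E : {set {set T}}) d :
  E \subset potential_edges T -> d * #|T| < #|E| ->
  exists2 C : {set T}, C != set0 &
    {in C, forall x, d < #|[set y | adjacent_in E C x y]|}.
Proof.
move=> Epot ltE; pose dense (C : {set T}) := d * #|C| < #|edges_in E C|.
have denseT : dense setT.
  rewrite /dense cardsT; apply: leq_trans ltE _; apply: subset_leq_card.
  by apply/subsetP => f fE; rewrite inE fE subsetT.
case: (@arg_minnP _ setT dense (fun C => #|C|) denseT) => C denseC Cmin.
exists C.
  apply: contraTneq denseC => ->; rewrite /dense cards0 muln0 -leqNgt leqn0 cards_eq0.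
  apply/eqP/setP => f; rewrite !inE subset0; apply/andP => -[fE /eqP f0].
  by have := subsetP Epot f fE; rewrite f0 inE cards0.
move=> x xC; set N := [set y | _].
have sparse : #|edges_in E (C :\ x)| <= d * #|C :\ x|.
  rewrite leqNgt; apply/negP => /Cmin.
  by rewrite [#|C|](cardsD1 x) xC add1n ltnn.
have cover : edges_in E C \subset
    edges_in E (C :\ x) :|: [set [set x; y] | y in N].
  apply/subsetP => f; rewrite !inE => /andP[fE fC].
  have [xf|xf] := boolP (x \in f); last first.
    rewrite fE; apply/orP; left; apply/subsetP => y yf.
    by rewrite !inE (subsetP fC y yf) andbT; apply: contraNneq xf => <-.
  apply/orP; right; have := subsetP Epot f fE.
  rewrite inE => /cards2P[a [b [ab fab]]].
  have [y fy] : exists y, f = [set x; y].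
    move: xf; rewrite fab !inE => /orP[/eqP ->|/eqP ->]; first by exists b.
    by exists a; rewrite setUC.
  apply/imsetP; exists y => //; rewrite inE /adjacent_in xC -fy fE andbT.
  by rewrite (subsetP fC) // fy set22.
have leN : #|[set [set x; y] | y in N]| <= #|N| by exact: leq_imset_card.
have leE : #|edges_in E C| <= #|edges_in E (C :\ x)| + #|[set [set x; y] | y in N]|.
  exact: leq_trans (subset_leq_card cover) (leq_card_setU _ _).
move: denseC; rewrite /dense (cardsD1 x C) xC mulnDr muln1.
by move: sparse leN leE; clear; lia.
Qed.

Lemma sum_pred_card (I : finType) (A : {set I}) (P : pred I) :
  \sum_(i in A) (P i : nat) = #|[set i in A | P i]|.
Proof. by rewrite -sum1dep_card big_mkcondr; apply: eq_bigr => i _; case: (P i). Qed.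

(** Each edge inside S' is counted at most twice by the degrees in S. *)
Lemma degree_sum_bound (T : finType) (E : {set {set T}}) (C S S' : {set T}) d :
  E \subset potential_edges T ->
  {in S, forall x, d <= #|[set y | adjacent_in E C x y]|} ->
  S \subset S' -> {in S, forall x y, adjacent_in E C x y -> y \in S'} ->
  d * #|S| <= 2 * #|edges_in E S'|.
Proof.
move=> Epot deg SS' clS.
have deg_f x : x \in S -> d <= \sum_(f in edges_in E S') (x \in f).
  move=> xS; rewrite (sum_pred_card _ (fun f : {set T} => x \in f)); apply: leq_trans (deg x xS) _.
  rewrite -(card_imset _ (@set2_inj T x)); apply: subset_leq_card.
  apply/subsetP => _ /imsetP[y yN ->]; rewrite inE in yN.
  rewrite !inE eqxx andbT; have /and3P[_ _ ->] := yN.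
  by rewrite subUset !sub1set (subsetP SS') // (clS x).
rewrite mulnC -sum_nat_const.
apply: (@leq_trans (\sum_(x in S) \sum_(f in edges_in E S') (x \in f))).
  exact: leq_sum.
rewrite exchange_big /= mulnC -sum_nat_const; apply: leq_sum => f.
rewrite inE => /andP[fE _].
rewrite -(card_edge Epot fE).
rewrite sum_pred_card; apply: subset_leq_card.
by apply/subsetP => x; rewrite inE => /andP[].
Qed.

(** * Subgraphs of locally sparse graphs *)

(** The search of long_cycle_from_stack started with an empty stack. *)
Lemma core_has_long_cycle (T : finType) (E : {set {set T}}) (C : {set T}) s l :
  0 < s <= #|C| -> 1 < l ->
  (forall S : {set T}, S \subset C -> s <= #|S| < s.*2 ->
     l <= #|outer_boundary (adjacent_in E C) S|) ->
  exists c, [/\ uniq c, cycle (adjacent_in E C) c & l < size c].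
Proof.
move=> /andP[s_gt0 sC] l_gt1 expC.
apply: (@long_cycle_from_stack T _ s l C [::]) => //.
- exact: adjacent_in_sym.
- exact: ltnW.
- by move=> x _ y /and3P[_ -> _].
- by move=> z [].
Qed.

(** The case s = 1 of the cycle search: in a graph of minimum degree two, the
    boundary of a single vertex has two elements, which gives a cycle of length
    at least three. *)
Lemma cycle_of_many_edges (T : finType) (E : {set {set T}}) :
  E \subset potential_edges T -> #|T| < #|E| ->
  exists c, [/\ uniq c, 2 < size c & cycle_edges c \subset E].
Proof.
move=> Epot ltE; have [||C C0 deg] := @min_degree_subgraph T E 1 => //.
  by rewrite mul1n.
have [|||c [c_uniq c_cycle c_size]] := @core_has_long_cycle T E C 1 2 => //.
- by rewrite card_gt0.
- move=> S SC /andP[S1 S2]; have /cards1P[x Sx] : #|S| == 1 by rewrite eqn_leq S1 andbT -ltnS.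
  have xC : x \in C by rewrite (subsetP SC) // Sx inE.
  apply: leq_trans (deg x xC) _; apply: subset_leq_card; apply/subsetP => y.
  rewrite !inE Sx => adj; apply/andP; split.
    have /and3P[_ _ /(subsetP Epot)] := adj.
    by rewrite potential_edge_neq inE eq_sym.
  by apply/exists_inP; exists x; rewrite ?inE.
- by exists c; split=> //; exact: cycle_edges_sub c_cycle.
Qed.

(** The bound reads e(S) <= #|S| (K + #|S| / M), cleared of its denominator:
    vertex sets of size up to K M span O(K) edges per vertex, and the bound
    grows linearly beyond that size. *)
Definition locally_sparse (T : finType) (K M : nat) (E : {set {set T}}) : Prop :=
  forall S : {set T}, M * #|edges_in E S| <= #|S| * (K * M + #|S|).

Lemma locally_sparse_sub (T : finType) K M (E E' : {set {set T}}) :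
  E' \subset E -> locally_sparse K M E -> locally_sparse K M E'.
Proof.
move=> sub spE S; apply: leq_trans (spE S); rewrite leq_mul2l; apply/orP; right.
apply: subset_leq_card; apply/subsetP => f; rewrite !inE => /andP[/(subsetP sub) -> //].
Qed.

(** Take a subgraph of minimum degree at least d. A set S of between s and 2s
    vertices together with its boundary spans at least d #|S| / 2 edges; were
    the boundary smaller than s, all of them would lie inside fewer than 3s
    vertices, more than local sparsity allows. *)
Lemma locally_sparse_long_cycle (T : finType) (E : {set {set T}}) K M d s :
  E \subset potential_edges T -> locally_sparse K M E ->
  12 * K <= d -> 1 < s -> 37 * s <= M * d -> d * #|T| < #|E| ->
  exists C, [/\ is_cycle C, C \subset E & s <= #|C|].
Proof.
move=> Epot spE Kd s_gt1 sMd ltE.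
have [C C0 deg] := min_degree_subgraph Epot ltE.
have degd x : x \in C -> d <= #|[set y | adjacent_in E C x y]|.
  by move/deg/ltnW.
have C_gt0 : 0 < #|C| by rewrite card_gt0.
have sC : s <= #|C|.
  have bound : d * #|C| <= 2 * #|edges_in E C|.
    by apply: (degree_sum_bound Epot degd) => // x xC y /and3P[].
  have [//|Cs] := leqP s #|C|.
  suff : M * d <= 2 * (K * M + #|C|) by clear - Kd s_gt1 sMd Cs; nia.
  rewrite -(leq_pmul2l C_gt0).
  by move: bound (spE C); clear; nia.
have [|||c [c_uniq c_cycle c_size]] := @core_has_long_cycle T E C s s => //.
- by rewrite sC ltnW.
- move=> S SC /andP[sS S2s]; set B := outer_boundary _ S; rewrite leqNgt; apply/negP => Bs.
  have S_gt0 : 0 < #|S| by apply: leq_trans sS; exact: ltnW.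
  have bound : d * #|S| <= 2 * #|edges_in E (S :|: B)|.
    apply: (@degree_sum_bound T E C) => //; first by move=> x /(subsetP SC)/degd.
      exact: subsetUl.
    move=> x xS y adj; rewrite !inE; case: (y \in S) => //=.
    by apply/exists_inP; exists x.
  have leU : #|S :|: B| <= #|S| + #|B| by exact: leq_card_setU.
  suff : M * d <= 4 * (K * M + 3 * s) by move: Kd s_gt1 sMd; clear; nia.
  rewrite -(leq_pmul2l S_gt0).
  have := spE (S :|: B); set u := #|S :|: B| in leU *.
  have u3 : u <= 3 * s by move: leU Bs S2s; clear; lia.
  have u2 : u <= 2 * #|S| by move: leU Bs sS; clear; lia.
  have : u * (K * M + u) <= 2 * #|S| * (K * M + 3 * s) by rewrite leq_mul ?leq_add2l.
  by move: bound; clear; nia.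
- exists (cycle_edges c); split; first by exists c; split=> //; exact: leq_trans c_size.
    exact: cycle_edges_sub c_cycle.
  by rewrite card_cycle_edges ?(ltnW c_size) // (leq_ltn_trans s_gt1).
Qed.

(** The conclusion is a decomposition of E' relative to that of the remainder
    E'', so that rounds of removal can be chained. *)
Lemma remove_long_cycles (T : finType) (E : {set {set T}}) m L :
  0 < L ->
  (forall E' : {set {set T}}, E' \subset E -> m < #|E'| ->
     exists C, [/\ is_cycle C, C \subset E' & L <= #|C|]) ->
  forall E' : {set {set T}}, E' \subset E -> exists2 E'' : {set {set T}}, E'' \subset E' /\ #|E''| <= m &
    exists2 t, t * L <= #|E'| &
      forall k, decomposable_into k E'' -> decomposable_into (t + k) E'.
Proof.
move=> L_gt0 cyc E'; have [n] := ubnP #|E'|; elim: n E' => // n IHn E' ltE' subE.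
have [le_m|lt_m] := leqP #|E'| m.
  by exists E' => //; exists 0.
have [C [cycC CE' LC]] := cyc E' subE lt_m.
have C_gt0 := leq_trans L_gt0 LC.
have cardD : #|E'| = #|C| + #|E' :\: C| by rewrite (cardsD E' C) (setIidPr CE') subnKC ?subset_leq_card.
have [||E'' [subE'' leE''] [t tL dec]] := IHn (E' :\: C).
- by move: ltE' C_gt0; rewrite cardD; clear; lia.
- exact: subset_trans (subsetDl _ _) subE.
exists E''; first by split=> //; exact: subset_trans subE'' (subsetDl _ _).
exists t.+1 => [|k decE'']; first by rewrite mulSn cardD leq_add.
rewrite -(setID E' C) (setIidPr CE'); apply: (@decomposableU _ 1 (t + k)).
- by rewrite -setI_eq0 setIDA setDIl setDv set0I.
- by apply: decomposable1; [rewrite -card_gt0 | left].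
- exact: dec.
Qed.

(** While the average degree is d there is a cycle of length proportional to
    M d, so halving the number of edges costs O(n / M) cycles. The hypothesis
    24 K i <= M makes the total over i halvings at most the number of
    vertices; the at most 12 K #|T| edges that remain are taken one by one. *)
Lemma locally_sparse_decomposition (T : finType) (E : {set {set T}}) K M i :
  E \subset potential_edges T -> locally_sparse K M E -> 4 <= K -> 1 < M ->
  24 * K * i <= M -> #|E| <= 2 ^ i * (12 * K * #|T|) ->
  forall E' : {set {set T}}, E' \subset E -> decomposable_into ((12 * K).+1 * #|T|) E'.
Proof.
move=> Epot spE K4 M_gt1 iM leE E' subE; set A := 12 * K * #|T|.
suff [E'' [subE'' leE''] [t tM dec]] : exists2 E'' : {set {set T}}, E'' \subset E' /\ #|E''| <= A &
    exists2 t, t * M <= i * (2 * A) &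
      forall k, decomposable_into k E'' -> decomposable_into (t + k) E'.
  have /dec := decomposable_edges (subset_trans subE'' (subset_trans subE Epot)).
  apply: decomposable_leq; rewrite mulSn leq_add //.
  suff : t * M <= #|T| * M by rewrite leq_pmul2r // (ltnW M_gt1).
  apply: leq_trans tM _; rewrite /A; move: iM; clear; nia.
have {}leE : #|E'| <= 2 ^ i * A by exact: leq_trans (subset_leq_card subE) leE.
elim: i E' subE leE {iM} => [|i IHi] E' subE leE.
  by exists E'; [rewrite -(mul1n A) | exists 0].
have cyc (E2 : {set {set T}}) : E2 \subset E -> 2 ^ i * A < #|E2| ->
    exists C, [/\ is_cycle C, C \subset E2 & 2 ^ i * M <= #|C|].
  move=> subE2 ltE2.
  apply: (@locally_sparse_long_cycle T E2 K M (12 * K * 2 ^ i)).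
  - exact: subset_trans subE2 Epot.
  - exact: locally_sparse_sub subE2 spE.
  - by rewrite leq_pmulr ?expn_gt0.
  - by rewrite (leq_trans M_gt1) // leq_pmull ?expn_gt0.
  - by move: K4; clear; nia.
  - by apply: leq_ltn_trans ltE2; rewrite /A; clear; nia.
have L_gt0 : 0 < 2 ^ i * M by rewrite muln_gt0 expn_gt0 (ltnW M_gt1).
have [E1 [E1E' leE1] [t1 t1L dec1]] := remove_long_cycles L_gt0 cyc subE.
have [||E'' [subE'' leE''] [t tM dec]] := IHi E1 => //.
  exact: subset_trans E1E' subE.
exists E''; first by split=> //; exact: subset_trans subE'' E1E'.
exists (t1 + t) => [|k /dec/dec1]; last by rewrite addnA.
rewrite mulnDl mulSn leq_add //.
have := leq_trans t1L leE; have : 0 < 2 ^ i by rewrite expn_gt0.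
by rewrite expnS; clear; nia.
Qed.

(** * Path systems in which every vertex is an end twice *)

Section PathEdges.

Variable T : finType.
Implicit Types (p q A C : seq T) (x y z v : T) (f : {set T}).

Definition path_edges p : seq {set T} :=
  if p is x :: s then pairmap (fun a b => [set a; b]) x s else [::].

(** A trivial path has two ends, both at its only vertex. *)
Definition path_ends p z : nat :=
  if p is x :: s then (x == z) + (last x s == z) else 0.

Lemma path_edges_cat A v C :
  path_edges (A ++ v :: C) = path_edges (rcons A v) ++ path_edges (v :: C).
Proof. by case: A => // a A; rewrite -cat_rcons /= pairmap_cat last_rcons. Qed.

Lemma path_edges_rcons x A v :
  path_edges (rcons (x :: A) v) = rcons (path_edges (x :: A)) [set last x A; v].
Proof. by rewrite /= -cats1 pairmap_cat /= cats1. Qed.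

Lemma path_edges_rev p : path_edges (rev p) = rev (path_edges p).
Proof.
elim: p => // x [|y s] //= IHp.
rewrite !rev_cons -[rcons (rcons _ _) _]cats1 cat_rcons path_edges_cat /=.
by rewrite -rev_cons IHp cats1 setUC.
Qed.

Lemma path_ends_rev p z : path_ends (rev p) z = path_ends p z.
Proof.
case/lastP: p => // p y; rewrite rev_rcons.
case: p => [|x s] //=.
by rewrite rev_cons !last_rcons addnC.
Qed.

Lemma cycle_edges_path x s : uniq (x :: s) ->
  cycle_edges (x :: s) = [set f in path_edges (x :: rcons s x)].
Proof.
move=> s_uniq; suff -> : path_edges (x :: rcons s x) =
    [seq [set z; next (x :: s) z] | z <- x :: s].
  by apply/setP => f; rewrite inE; apply/imsetP/mapP => -[z zs ->]; exists z.
apply: (@eq_from_nth _ set0); first by rewrite size_pairmap size_rcons size_map.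
rewrite size_pairmap size_rcons => i lti.
rewrite (nth_pairmap x) ?size_rcons // (nth_map x) // next_nth mem_nth // index_uniq //.
congr [set _; _]; last first.
  by rewrite nth_rcons; case: ltnP => // le_i; rewrite if_same nth_default.
by case: i lti => //= i lti; rewrite nth_rcons; have -> : i < size s by [].
Qed.

End PathEdges.

Section PathSystems.

Variables (T I : finType).
Implicit Types (P Q : I -> seq T) (x y z v : T) (f : {set T}) (i j : I).

(** Multiplicities rather than sets of edges: modifying a single path changes
    these sums by linear identities, and edge-disjointness is a bound by 1. *)
Definition edge_mult P f := \sum_i count_mem f (path_edges (P i)).
Definition end_mult P z := \sum_i path_ends (P i) z.

Definition replace_path P i p : I -> seq T := fun j => if j == i then p else P j.

Lemma replace_pathE P i p j : replace_path P i p j = if j == i then p else P j.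
Proof. by []. Qed.

Lemma sum_replace_path (F : seq T -> nat) P i p :
  \sum_j F (replace_path P i p j) + F (P i) = \sum_j F (P j) + F p.
Proof.
rewrite (bigD1 i) //= [in RHS](bigD1 i) //= replace_pathE eqxx.
rewrite [X in F p + X](eq_bigr (fun j => F (P j))); last first.
  by move=> j /negbTE ji; rewrite replace_pathE ji.
lia.
Qed.

Lemma edge_mult_replace P i p f :
  edge_mult (replace_path P i p) f + count_mem f (path_edges (P i)) =
  edge_mult P f + count_mem f (path_edges p).
Proof. exact: (sum_replace_path (fun p => count_mem f (path_edges p))). Qed.

Lemma end_mult_replace P i p z :
  end_mult (replace_path P i p) z + path_ends (P i) z = end_mult P z + path_ends p z.
Proof. exact: (sum_replace_path (fun q => path_ends q z) P i p). Qed.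

(** What the recursion in move_end must remember about a path through v, so
    that a piece cut off at v can be glued back: its vertex set, and whether it
    ends at v. Both are insensitive to reversal. *)
Definition rerouted v p p' := perm_eq p' p /\ (0 < path_ends p v -> 0 < path_ends p' v).

(** To add the edge vx, take a path ending at x. If it avoids v, prolong it to
    v. Otherwise it has the form A v C, where A runs from x to some neighbour
    y of v; replacing vy by vx turns it into (rev A) v C, and vy remains to be
    added. The piece A is cut off during the recursion. This ensures
    termination, since the total length decreases, and it preserves the
    hypothesis that x and all neighbours of v are ends of paths: only x loses
    an end, and x is not a neighbour of v in the system. *)
Lemma move_end P v x :
  (forall i, uniq (P i)) -> (forall f, edge_mult P f <= 1) ->
  x != v -> edge_mult P [set v; x] = 0 ->
  (forall z, z != v -> (z == x) || (0 < edge_mult P [set v; z]) -> 0 < end_mult P z) ->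
  exists P', [/\ forall i, uniq (P' i),
    forall f, edge_mult P' f = edge_mult P f + (f == [set v; x]),
    forall z, end_mult P' z + (z == x) = end_mult P z + (z == v) &
    forall i, v \in P i -> rerouted v (P i) (P' i)].
Proof.
have [N] := ubnP (\sum_i size (P i)).
elim: N P x => // N IHN P x; rewrite ltnS => leN P_uniq P_simple xv vx0 nbr_end.
have [i xi] : exists i, 0 < path_ends (P i) x.
  have : 0 < end_mult P x by apply: nbr_end; rewrite ?eqxx.
  rewrite lt0n sum_nat_eq0 negb_forall => /existsP[i]; rewrite -lt0n => xi.
  by exists i.
wlog [s Pi] : P leN P_uniq P_simple vx0 nbr_end xi / exists s, P i = x :: s.
  move=> Pwlog; case Pi: (P i) (xi) => [|a s] //=.
  have [ax _|_] := eqVneq a x.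
    by apply: Pwlog => //; exists s; rewrite Pi ax.
  rewrite add0n lt0b => /eqP lastx; pose P2 := replace_path P i (rev (P i)).
  have P2_edges f : edge_mult P2 f = edge_mult P f.
    have := edge_mult_replace P i (rev (P i)) f.
    by rewrite path_edges_rev count_rev => /addIn.
  have P2_ends z : end_mult P2 z = end_mult P z.
    by have := end_mult_replace P i (rev (P i)) z; rewrite path_ends_rev => /addIn.
  have P2i j : P2 j = if j == i then rev (P i) else P j by [].
  have [|||||||P' [P'_uniq P'_edges P'_ends P'_rer]] := Pwlog P2.
  - have := sum_replace_path size P i (rev (P i)); rewrite size_rev => /addIn.
    by rewrite -/P2 => ->.
  - by move=> j; rewrite P2i; case: eqP => // _; rewrite rev_uniq.
  - by move=> f; rewrite P2_edges.
  - by rewrite P2_edges.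
  - by move=> z zv; rewrite P2_edges P2_ends; apply: nbr_end.
  - by rewrite P2i eqxx path_ends_rev.
  - exists (rev (belast a s)); rewrite P2i eqxx Pi lastI rev_rcons lastx //.
  exists P'; split=> // [f|z|j vj].
  - by rewrite P'_edges P2_edges.
  - by rewrite P'_ends P2_ends.
  - have := P'_rer j; rewrite P2i; case: eqP vj => [-> vi|_ vj]; last by apply.
    rewrite mem_rev /rerouted path_ends_rev => /(_ vi)[perm_P' endP']; split=> //.
    by apply: perm_trans perm_P' _; rewrite perm_rev.
have [vPi|vPi] := boolP (v \in P i); last first.
  (* The path avoids v: prolong it. *)
  exists (replace_path P i (v :: P i)); split.
  - by move=> j; rewrite replace_pathE; case: eqP => // _; rewrite /= vPi P_uniq.
  - move=> f; have := edge_mult_replace P i (v :: P i) f.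
    by rewrite Pi /= [_ == f]eq_sym; clear; lia.
  - move=> z; have := end_mult_replace P i (v :: P i) z.
    by rewrite Pi /= ![_ == z]eq_sym; clear; lia.
  - move=> j vj; rewrite replace_pathE; case: eqP vj => [-> vi|_ _].
      by rewrite vi in vPi.
    by split.
have {vPi} vs : v \in s by move: vPi; rewrite Pi in_cons eq_sym (negbTE xv).
case/splitPr: vs Pi => A C Pi; set y := last x A.
have Pi_uniq : uniq (x :: A ++ v :: C) by rewrite -Pi.
(* Cut off A, together with the edge from y to v. *)
pose Q := replace_path P i (v :: C).
have Q_edges f : edge_mult Q f + count_mem f (path_edges (x :: A)) + (f == [set v; y]) =
    edge_mult P f.
  have := edge_mult_replace P i (v :: C) f.
  rewrite Pi -cat_cons path_edges_cat path_edges_rcons count_cat -cats1 count_cat /=.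
  by rewrite [[set last x A; v]]setUC [_ == f]eq_sym -/Q -/y; clear; lia.
have Q_ends z : end_mult Q z + (z == x) = end_mult P z + (z == v).
  have := end_mult_replace P i (v :: C) z; rewrite Pi /= last_cat /= ![_ == z]eq_sym -/Q.
  by clear; lia.
have yA : y \in x :: A by exact: mem_last.
have yv : y != v.
  apply: contraTneq Pi_uniq => yv; rewrite -cat_cons cat_uniq.
  by apply/negP => /and3P[_ /hasPn/(_ v)]; rewrite mem_head -yv yA => /(_ isT).
have vy1 : edge_mult P [set v; y] = 1.
  by have := P_simple [set v; y]; rewrite -Q_edges eqxx; clear; lia.
have vy0 : edge_mult Q [set v; y] = 0.
  by have := Q_edges [set v; y]; rewrite eqxx vy1; clear; lia.
have [||||||Q' [Q'_uniq Q'_edges Q'_ends Q'_rer]] := IHN Q y.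
- have := sum_replace_path size P i (v :: C); rewrite Pi /= size_cat /= -/Q.
  by move: leN; clear; lia.
- move=> j; rewrite /Q replace_pathE; case: eqP => // _.
  by move: Pi_uniq; rewrite -cat_cons cat_uniq => /and3P[].
- by move=> f; have := P_simple f; have := Q_edges f; clear; lia.
- by [].
- by [].
- move=> z zv zy.
  have vz : 0 < edge_mult P [set v; z].
    case/orP: zy => [/eqP ->|]; first by rewrite vy1.
    by have := Q_edges [set v; z]; clear; lia.
  have zx : z != x by apply: contraTneq vz => ->; rewrite vx0.
  have := nbr_end z zv; rewrite vz orbT => /(_ isT).
  by have := Q_ends z; rewrite (negbTE zv) (negbTE zx); clear; lia.
have Qi : Q i = v :: C by rewrite /Q replace_pathE eqxx.
(* Up to reversal, the path that v :: C became still starts at v. *)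
have [C' permC [C'_edges C'_ends]] : exists2 C', perm_eq (v :: C') (v :: C) &
    (forall f, count_mem f (path_edges (v :: C')) = count_mem f (path_edges (Q' i))) /\
    (forall z, path_ends (v :: C') z = path_ends (Q' i) z).
  have [] := Q'_rer i; first by rewrite Qi mem_head.
  rewrite Qi /= eqxx => perm_Q' /(_ isT).
  case Q'i : (Q' i) perm_Q' => [|a C'] perm_Q' // endv.
  have : 0 < (a == v) + (last a C' == v) by [].
  have [av _|av] := eqVneq a v; first by exists C'; [rewrite -{1}av | rewrite -av].
  rewrite add0n lt0b => /eqP lastv.
  have rev_eq : rev (a :: C') = v :: rev (belast a C').
    by rewrite lastI rev_rcons lastv.
  exists (rev (belast a C')); first by rewrite -rev_eq perm_rev.
  split=> z; last by have := path_ends_rev (a :: C') z; rewrite rev_eq.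
  by have := count_rev (pred1 z) (path_edges (a :: C')); rewrite -path_edges_rev rev_eq.
pose p := rev (x :: A) ++ v :: C'.
have p_perm : perm_eq p (P i) by rewrite Pi -cat_cons; apply: perm_cat; rewrite ?perm_rev.
exists (replace_path Q' i p); split.
- move=> j; rewrite replace_pathE; case: eqP => // _.
  by rewrite (perm_uniq p_perm).
- move=> f; have := edge_mult_replace Q' i p f; rewrite -C'_edges.
  rewrite path_edges_cat -rev_cons path_edges_rev count_cat count_rev.
  have -> : count_mem f (path_edges (v :: x :: A)) =
      (f == [set v; x]) + count_mem f (path_edges (x :: A)) by rewrite /= [_ == f]eq_sym.
  by have := Q_edges f; have := Q'_edges f; clear; lia.
- move=> z; have := end_mult_replace Q' i p z; rewrite -C'_ends.
  have -> : path_ends p z = (z == y) + (last v C' == z).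
    rewrite /p rev_cons /y; case/lastP: (A) => [|A' a] /=; first by rewrite [x == z]eq_sym.
    by rewrite rev_rcons /= !last_rcons last_cat /= [a == z]eq_sym.
  have := Q_ends z; have := Q'_ends z; rewrite /= [v == z]eq_sym.
  by clear; lia.
- move=> j vj; rewrite replace_pathE; case: eqP => [ji|/eqP/negbTE ji].
    split; first by rewrite ji.
    rewrite ji Pi /= (negbTE xv) last_cat /= add0n lt0b => /eqP lastv.
    have C0 : C = [::].
      case: C Pi Pi_uniq lastv {Q Q_edges Q_ends vy0 Q'_edges Q'_ends Q'_rer Qi permC p_perm Q'_uniq} => // c C _.
      rewrite -cat_cons cat_uniq => /and3P[_ _ /andP[/negP vC _]] lastv.
        by case: vC; have := mem_last c C; rewrite -[last c C]/(last v (c :: C)) lastv.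
    have := perm_size permC; rewrite C0 /= => -[/size0nil C'0].
    rewrite /p C'0 cats1; case: (rev _) => [|a l] /=; first by rewrite eqxx.
    by rewrite last_rcons eqxx addnS.
  by have := Q'_rer j; rewrite /Q replace_pathE ji; apply.
Qed.

(** Along the walk from a, the only change in the numbers of ends is that one
    end has moved from a to the current vertex x; in particular every vertex
    keeps at least one end, as move_end demands. *)
Lemma add_walk P a x s :
  (forall i, uniq (P i)) -> (forall f, edge_mult P f <= 1) ->
  uniq (path_edges (x :: s)) -> {subset path_edges (x :: s) <= potential_edges T} ->
  {in path_edges (x :: s), forall f, edge_mult P f = 0} ->
  (forall z, end_mult P z + (z == a) = 2 + (z == x)) ->
  exists P', [/\ forall i, uniq (P' i),
    forall f, edge_mult P' f = edge_mult P f + (f \in path_edges (x :: s)) &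
    forall z, end_mult P' z + (z == a) = 2 + (z == last x s)].
Proof.
elim: s P x => [|y s IHs] P x P_uniq P_simple s_uniq s_pot s_new P_ends.
  by exists P; split=> // f; rewrite addn0.
have xy_mem : [set x; y] \in path_edges [:: x, y & s] by rewrite mem_head.
have xy : x != y by rewrite -potential_edge_neq s_pot.
have [||P' [P'_uniq P'_edges P'_ends _]] := @move_end P y x P_uniq P_simple xy.
- by rewrite setUC s_new.
- by move=> z _ _; have := P_ends z; clear; lia.
move: s_uniq; rewrite [path_edges _]/= cons_uniq => /andP[xy_s s_uniq].
have xy_new f : f \in path_edges (y :: s) -> (f == [set y; x]) = false.
  by move=> fs; apply: contraNF xy_s => /eqP fE; rewrite setUC -fE.
have [|||||P'' [P''_uniq P''_edges P''_ends]] := IHs P' y P'_uniq => //.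
- move=> f; rewrite P'_edges; have [->|_] := eqVneq f [set y; x].
    by rewrite setUC s_new.
  by rewrite addn0.
- by move=> f fs; apply: s_pot; rewrite [path_edges _]/= in_cons fs orbT.
- move=> f fs; rewrite P'_edges xy_new // addn0 s_new //.
  by rewrite [path_edges _]/= in_cons fs orbT.
- by move=> z; have := P_ends z; have := P'_ends z; clear; lia.
exists P''; split=> // f; rewrite P''_edges P'_edges -addnA; congr (_ + _).
suff : (f == [set y; x]) + (f \in path_edges (y :: s)) = (f \in path_edges [:: x, y & s]) by [].
have -> : (f \in path_edges [:: x, y & s]) = (f == [set y; x]) || (f \in path_edges (y :: s)).
  by rewrite [[set y; x]]setUC.
by case: (boolP (f \in _)) => [/xy_new ->|] //; case: eqP.
Qed.

End PathSystems.

(** Start from trivial paths at all vertices, and add edge-disjoint cycles one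
    at a time: after a closed walk, the end moved along it is back at its
    origin. *)
Lemma path_decomposition (T : finType) (E : {set {set T}}) :
  E \subset potential_edges T ->
  exists (F : {set {set T}}) (P : T -> seq T),
    [/\ F \subset E, #|F| <= #|T|, forall i, uniq (P i),
        forall f, edge_mult P f = (f \in E :\: F) & forall z, end_mult P z = 2].
Proof.
have [n] := ubnP #|E|; elim: n E => // n IHn E ltE Epot.
have [leE|gtE] := leqP #|E| #|T|.
  exists E, (fun v => [:: v]); split=> //.
    by move=> f; rewrite setDv inE /edge_mult big1.
  move=> z; rewrite /end_mult (bigD1 z) //= eqxx big1 // => v /negbTE.
  by rewrite /path_ends /= => ->.
have [c [c_uniq c_size cE]] := cycle_of_many_edges Epot gtE.
have c_card := card_cycle_edges c_uniq c_size.
case: c c_uniq c_size cE c_card => // x s c_uniq c_size cE c_card.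
set C := cycle_edges _ in cE c_card.
have CE : C = [set f in path_edges (x :: rcons s x)] by exact: cycle_edges_path.
have cardE : #|E| = #|C| + #|E :\: C|.
  by rewrite (cardsD E C) (setIidPr cE) subnKC ?subset_leq_card.
have Epot' : E :\: C \subset potential_edges T by exact: subset_trans (subsetDl _ _) Epot.
have [|F [P [FE leF P_uniq P_edges P_ends]]] := IHn (E :\: C) _ Epot'.
  by move: ltE; rewrite cardE c_card /=; clear; lia.
have [|||||P' [P'_uniq P'_edges P'_ends]] := @add_walk T T P x x (rcons s x) P_uniq.
- by move=> f; rewrite P_edges; case: (_ \in _).
- apply/card_uniqP; rewrite -cardsE -CE c_card.
  by rewrite size_pairmap size_rcons.
- move=> f fc; apply: (subsetP (subset_trans cE Epot)).
  by rewrite CE inE.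
- by move=> f fc; rewrite P_edges !inE CE inE fc andbF.
- by move=> z; rewrite P_ends.
have FC f : f \in F -> f \notin C by move/(subsetP FE); rewrite inE => /andP[].
exists F, P'; split=> //.
- exact: subset_trans FE (subsetDl _ _).
- move=> f; rewrite P'_edges P_edges !inE -[f \in path_edges _](in_set (mem (path_edges (x :: rcons s x)))).
  rewrite -CE; case: (boolP (f \in C)) => fC /=; rewrite ?andbF ?addn0 //.
  by rewrite (subsetP cE _ fC) andbT; case: (boolP (f \in F)) => // /FC; rewrite fC.
- by move=> z; have := P'_ends z; rewrite last_rcons => /addIn.
Qed.

(** * Closing path systems to cycles *)

(** Colouring one vertex at a time, at most d of the d + 1 colours are
    excluded. *)
Lemma greedy_colouring (I : finType) (r : rel I) d :
  symmetric r -> (forall i, #|[set j | (j != i) && r i j]| <= d) ->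
  exists col : I -> 'I_d.+1, forall i j, i != j -> r i j -> col i != col j.
Proof.
move=> r_sym deg.
suff [col colP] : exists col : I -> 'I_d.+1,
    {in enum I &, forall i j, i != j -> r i j -> col i != col j}.
  by exists col => i j; apply: colP; rewrite mem_enum.
elim: (enum I) => [|i s [col colP]]; first by exists (fun=> ord0).
have [c cP] : exists c, c \notin [set col j | j in [set j | (j != i) && r i j]].
  apply/existsP; rewrite -negb_forall; apply/negP => /forallP full.
  have : #|'I_d.+1| <= #|[set col j | j in [set j | (j != i) && r i j]]|.
    by apply: subset_leq_card; apply/subsetP => c _; exact: full.
  rewrite card_ord leqNgt ltnS (leq_trans _ (deg i)) //; exact: leq_imset_card.
have cN j : j != i -> r i j -> c != col j.
  move=> ji rij; apply: contraNneq cP => ->; apply: imset_f.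
  by rewrite inE ji.
exists (fun j => if j == i then c else col j) => j k; rewrite !in_cons.
case: (eqVneq j i) => [->|ji] /= js; case: (eqVneq k i) => [->|ki] /= ks; rewrite ?eqxx //.
- by move=> _; exact: cN.
- by move=> _ rji; rewrite eq_sym cN // r_sym.
- exact: colP.
Qed.

Lemma decomposable_bigcup (T I : finType) (J : {set I}) (G : I -> {set {set T}}) m :
  {in J, forall i, decomposable_into m (G i)} ->
  {in J &, forall i j, i != j -> [disjoint G i & G j]} ->
  decomposable_into (#|J| * m) (\bigcup_(i in J) G i).
Proof.
have [n] := ubnP #|J|; elim: n J => // n IHn J ltJ decG disG.
have [->|[i iJ]] := set_0Vmem J; first by rewrite big_set0; exact: decomposable0.
rewrite (big_setD1 i iJ) (cardsD1 i) iJ mulSn; apply: decomposableU.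
- apply/pred0P => f /=; apply/negP => /andP[fi /bigcupP[j /setD1P[ji jJ] fj]].
  by have := disG _ _ jJ iJ ji; move/pred0P/(_ f); rewrite /= fi fj.
- exact: decG.
- apply: IHn; first by move: ltJ; rewrite (cardsD1 i) iJ.
    by move=> j /setD1P[_]; exact: decG.
  by move=> j k /setD1P[_ jJ] /setD1P[_ kJ]; exact: disG.
Qed.

Lemma decomposable_cycle (T : finType) (C : {set {set T}}) :
  is_cycle C -> decomposable_into 1 C.
Proof.
move=> cycC; apply: decomposable1; last by left.
have [c [c_uniq c_size ->]] := cycC.
by rewrite -card_gt0 card_cycle_edges // (leq_trans _ c_size).
Qed.

Lemma path_vertex_edge (T : finType) (p : seq T) z :
  1 < size p -> z \in p -> exists2 f, f \in path_edges p & z \in f.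
Proof.
elim: p => // x [|y s] // IHp _; rewrite in_cons => /orP[/eqP ->|zs].
  by exists [set x; y]; rewrite ?mem_head ?set21.
case: s IHp zs => [|w s] IHp zs.
  by exists [set x; y]; rewrite ?mem_head //; move: zs; rewrite !inE => ->; rewrite orbT.
have [//|f fp zf] := IHp _ zs; exists f => //.
by rewrite [path_edges _]/= in_cons fp orbT.
Qed.

Lemma set2_bip_inj (T : finType) (U A : {set T}) u u' a a' :
  [disjoint U & A] -> u \in U -> u' \in U -> a \in A -> a' \in A ->
  [set u; a] = [set u'; a'] -> u = u' /\ a = a'.
Proof.
move=> /disjointFr dis uU uU' aA aA' eqs.
have : u \in [set u'; a'] by rewrite -eqs set21.
rewrite !inE => /orP[/eqP uu'|/eqP ua']; last by rewrite ua' dis in aA' * => //; rewrite -ua'.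
by split=> //; apply: (@set2_inj T u); rewrite eqs uu'.
Qed.

(** Every path with at least one edge is closed by a common neighbour in A of
    its ends. Paths that share an end use vertices of A with different labels
    blk, chosen by a greedy colouring: a path shares an end with at most four
    others. Hence no connecting edge is used twice. *)
Lemma close_paths (T : finType) (E R : {set {set T}}) (U A : {set T}) (blk : T -> 'I_5) :
  E \subset potential_edges T -> {in E, forall f : {set T}, f \subset U} ->
  [disjoint U & A] ->
  (forall u w b, u != w ->
     exists a, [/\ a \in A, blk a = b, [set u; a] \in R & [set w; a] \in R]) ->
  exists R' : {set {set T}}, [/\ R' \subset R,
    {in R', forall f, exists u a, [/\ u \in U, a \in A & f = [set u; a]]} &
    decomposable_into (2 * #|T|) (E :|: R')].
Proof.
move=> Epot EU UA hub.
have [F [P [FE leF P_uniq P_edges P_ends]]] := path_decomposition Epot.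
pose r i j := [exists z, (0 < path_ends (P i) z) && (0 < path_ends (P j) z)].
have r_sym : symmetric r by move=> i j; apply: eq_existsb => z; rewrite andbC.
have few_ends z : #|[set j | 0 < path_ends (P j) z]| <= 2.
  rewrite -[X in _ <= X](P_ends z) -sum1_card big_mkcond; apply: leq_sum => i _.
  by rewrite inE; case: ifP.
have r_deg i : #|[set j | (j != i) && r i j]| <= 4.
  case Pi: (P i) => [|x s].
    rewrite (_ : [set _ | _] = set0) ?cards0 //; apply/setP => j; rewrite !inE.
    by apply/andP => -[_ /existsP[z]]; rewrite Pi.
  apply: (@leq_trans #|[set j | 0 < path_ends (P j) x] :|: [set j | 0 < path_ends (P j) (last x s)]|).
    apply: subset_leq_card; apply/subsetP => j; rewrite !inE.
    move=> /andP[_ /existsP[z]]; rewrite Pi /= => /andP[].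
    have [->|_] := eqVneq x z; first by move=> _ ->.
    by have [->|_] := eqVneq (last x s) z; first by move=> _ ->; rewrite orbT.
  by apply: leq_trans (leq_card_setU _ _) _; rewrite (leq_add (few_ends _) (few_ends _)).
have [col colP] := greedy_colouring r_sym r_deg.
pose hd i := head i (P i); pose lt i := last i (P i).
pose J := [set i | 1 < size (P i)].
pose good i a := [&& a \in A, blk a == col i, [set hd i; a] \in R & [set lt i; a] \in R].
pose av i := odflt i [pick a | good i a].
have avP i : i \in J -> good i (av i).
  rewrite inE => szP; rewrite /av; case: pickP => //= none.
  have hl : hd i != lt i.
    have := P_uniq i; rewrite /hd /lt; case: (P i) szP => [|x [|y s]] //= _ /andP[xs _].
    by apply: contraNneq xs => ->; exact: mem_last.
  have [a [aA ab Ra1 Ra2]] := hub _ _ (col i) hl.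
  by have := none a; rewrite /good aA ab eqxx Ra1 Ra2.
have PiE i f : f \in path_edges (P i) -> f \in E :\: F.
  move=> fPi; have := P_edges f; case: (f \in _) => //.
  move/eqP; rewrite sum_nat_eq0 => /forallP/(_ i).
  by rewrite -leqn0 leqNgt -has_count => /hasP[]; exists f => /=.
have PJ i : path_edges (P i) != [::] -> i \in J by rewrite inE; case: (P i) => [|x [|y s]].
have PU i z : i \in J -> z \in P i -> z \in U.
  rewrite inE => szP /(path_vertex_edge szP)[f /PiE fE zf].
  by move: fE; rewrite inE => /andP[_ /EU/subsetP]; apply.
have hdP i : i \in J -> hd i \in P i by rewrite inE /hd; case: (P i) => //= x s _; rewrite mem_head.
have ltP i : i \in J -> lt i \in P i by rewrite inE /lt; case: (P i) => //= x s _; rewrite mem_last.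
pose Cs i := cycle_edges (av i :: P i).
have avA i : i \in J -> av i \in A by move/avP/and4P => [].
have AU a : a \in A -> a \notin U by move=> aA; apply: contraL aA => /(disjointFr UA) ->.
have Cs_uniq i : i \in J -> uniq (av i :: P i).
  move=> iJ; rewrite /= P_uniq andbT; apply: contra (AU _ (avA i iJ)); exact: PU.
have CsE i f : i \in J -> (f \in Cs i) =
    [|| f \in path_edges (P i), f == [set hd i; av i] | f == [set lt i; av i]].
  move=> iJ; rewrite /Cs cycle_edges_path ?Cs_uniq // inE.
  move: iJ; rewrite inE /hd /lt; case: (P i) => // x s _.
  rewrite -rcons_cons -[rcons (av i :: _) _]/(av i :: rcons (x :: s) (av i)).
  rewrite -[path_edges _]/([set av i; x] :: path_edges (rcons (x :: s) (av i))).
  rewrite path_edges_rcons in_cons mem_rcons in_cons [[set av i; x]]setUC /=.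
  by rewrite orbA orbC.
pose conn i := [set [set hd i; av i]; [set lt i; av i]].
exists (\bigcup_(i in J) conn i); split.
- apply/bigcupsP => i /avP/and4P[_ _ R1 R2].
  by rewrite subUset !sub1set R1 R2.
- move=> f /bigcupP[i iJ]; rewrite !inE => /orP[]/eqP ->.
    by exists (hd i), (av i); rewrite avA // (PU i) ?hdP.
  by exists (lt i), (av i); rewrite avA // (PU i) ?ltP.
have conn_notE f i : i \in J -> (f == [set hd i; av i]) || (f == [set lt i; av i]) -> f \notin E.
  move=> iJ fi; apply: contra (AU _ (avA i iJ)) => /EU/subsetP; apply.
  by case/orP: fi => /eqP ->; rewrite set22.
have -> : E :|: \bigcup_(i in J) conn i = F :|: \bigcup_(i in J) Cs i.
  apply/setP => f; rewrite !inE; apply/orP/orP => -[fE|/bigcupP[i iJ fi]].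
  - have [fF|fF] := boolP (f \in F); [by left | right].
    have := P_edges f; rewrite inE fF fE /= => sum1.
    have : 0 < edge_mult P f by rewrite sum1.
    rewrite lt0n sum_nat_eq0 negb_forall => /existsP[i]; rewrite -lt0n -has_count => /hasP[f' f'P /eqP ff'].
    rewrite {}ff' in f'P; have iJ : i \in J by apply: PJ; case: (path_edges _) f'P.
    by apply/bigcupP; exists i => //; rewrite CsE // f'P.
  - right; apply/bigcupP; exists i => //; rewrite CsE //.
    by move: fi; rewrite !inE => ->; rewrite orbT.
  - by left; exact: subsetP FE _ fE.
  - move: fi; rewrite CsE // => /orP[/PiE|fi].
      by rewrite inE => /andP[_ fE]; left.
    by right; apply/bigcupP; exists i => //; rewrite !inE.
apply: (@decomposable_leq _ (#|F| + #|J| * 1)).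
  by rewrite muln1 mul2n -addnn leq_add ?max_card.
apply: decomposableU.
- apply/pred0P => f /=; apply/negP => /andP[fF /bigcupP[i iJ]].
  rewrite CsE // => /orP[/PiE|/(conn_notE _ _ iJ)]; first by rewrite inE fF.
  by rewrite (subsetP FE).
- exact: decomposable_edges (subset_trans FE Epot).
apply: decomposable_bigcup.
- move=> i iJ; apply: decomposable_cycle; exists (av i :: P i).
  by split=> //; [exact: Cs_uniq | move: iJ; rewrite inE].
move=> i j iJ jJ ij; apply/pred0P => f /=; apply/negP; rewrite !CsE // => /andP[].
have share u : 0 < path_ends (P i) u -> 0 < path_ends (P j) u -> av i != av j.
  move=> ui uj; have := colP i j ij; have -> : r i j by apply/existsP; exists u; rewrite ui uj.
  move/(_ isT); have /and4P[_ /eqP <- _ _] := avP i iJ; have /and4P[_ /eqP <- _ _] := avP j jJ.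
  by apply: contraNneq => ->.
have endsP k u : k \in J -> (u == hd k) || (u == lt k) -> 0 < path_ends (P k) u.
  rewrite inE /hd /lt; case: (P k) => //= x s _ /orP[]/eqP ->; by rewrite eqxx ?addnS.
have connE k g : k \in J -> (g == [set hd k; av k]) || (g == [set lt k; av k]) ->
    exists u, [/\ u \in U, 0 < path_ends (P k) u & g = [set u; av k]].
  move=> kJ /orP[]/eqP ->; [exists (hd k) | exists (lt k)];
    by rewrite (PU k) ?hdP ?ltP // endsP ?eqxx ?orbT.
move=> /orP[fPi|fi] /orP[fPj|fj].
- have gt_i : 0 < count_mem f (path_edges (P i)) by rewrite -has_count has_pred1.
  have gt_j : 0 < count_mem f (path_edges (P j)) by rewrite -has_count has_pred1.
  have := P_edges f; rewrite (PiE i) // /edge_mult (bigD1 i) //= (bigD1 j) 1?eq_sym //=.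
  by case: (count_mem f _) gt_i => // m _; case: (count_mem f _) gt_j => // m' _; rewrite addSn addnS.
- by have := conn_notE _ _ jJ fj; move: (PiE i f fPi); rewrite inE => /andP[_ ->].
- by have := conn_notE _ _ iJ fi; move: (PiE j f fPj); rewrite inE => /andP[_ ->].
- have [u [uU ui fu]] := connE i f iJ fi; have [u' [uU' uj fu']] := connE j f jJ fj.
  have [uu' aa'] := set2_bip_inj UA uU uU' (avA i iJ) (avA j jJ) (etrans (esym fu) fu').
  by have := share u ui; rewrite aa' eqxx uu' => /(_ uj).
Qed.

(** * The seven lines of the Fano plane *)

(** The quadratic residues 1, 2, 4 form a perfect difference set modulo 7, so
    their translates are the lines of the Fano plane. The translate by k is
    attached to the point k. *)
Definition on_line (k l : 'I_7) : bool := (l + 7 - k) %% 7 \in [:: 1; 2; 4].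

Lemma on_line_pair (i j : 'I_7) : exists k, on_line k i && on_line k j.
Proof.
case: i j => -[|[|[|[|[|[|[|//]]]]]]] lti [[|[|[|[|[|[|[|//]]]]]]] ltj].
all: try by exists (@Ordinal 7 0 isT).
all: try by exists (@Ordinal 7 1 isT).
all: try by exists (@Ordinal 7 2 isT).
all: try by exists (@Ordinal 7 3 isT).
all: try by exists (@Ordinal 7 4 isT).
all: try by exists (@Ordinal 7 5 isT).
all: by exists (@Ordinal 7 6 isT).
Qed.

(** -1 is not a square modulo 7. *)
Lemma on_line_asym (k l : 'I_7) : on_line k l -> ~~ on_line l k.
Proof.
by case: k l => -[|[|[|[|[|[|[|//]]]]]]] ltk [[|[|[|[|[|[|[|//]]]]]]] ltl].
Qed.

(** An edge of E outside R goes to a family k whose line contains the colours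
    of both its vertices. The paths of this family are closed through vertices
    of colour k, which is not on the line, by edges of R that join colour k to
    a colour on the line k. By on_line_asym these sets of edges of R are
    disjoint for different k. *)
Lemma reservoir_decomposition (T : finType) (E R : {set {set T}})
    (kc : T -> 'I_7) (blk : T -> 'I_5) m :
  E \subset potential_edges T -> R \subset E ->
  (forall k b u w, u != w ->
     exists a, [/\ kc a = k, blk a = b, [set u; a] \in R & [set w; a] \in R]) ->
  (forall R' : {set {set T}}, R' \subset R -> decomposable_into m R') ->
  decomposable_into (14 * #|T| + m) E.
Proof.
move=> Epot RE hub decR.
pose U k := [set v | on_line k (kc v)]; pose A k := [set v | kc v == k].
pose fam (f : {set T}) := odflt ord0 [pick k | f \subset U k].
pose Ek k := [set f in E :\: R | fam f == k].
have EkE k : Ek k \subset E :\: R by apply/subsetP => f /setIdP[].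
have famP f : f \in E -> f \subset U (fam f).
  move=> fE; have /cards2P[x [y [_ fxy]]] : #|f| == 2 by rewrite (card_edge Epot fE).
  rewrite /fam; case: pickP => //= none; have [k /andP[kx ky]] := on_line_pair (kc x) (kc y).
  by have := none k; rewrite fxy subUset !sub1set !inE kx ky.
have UA k : [disjoint U k & A k].
  apply/pred0P => v /=; rewrite !inE; apply/negP => /andP[kv /eqP vk].
  by move: kv; rewrite vk => kk; have := on_line_asym kk; rewrite kk.
have [|R' R'P] := @fin_all_exists 'I_7 (fun=> {set {set T}}) (fun k (R' : {set {set T}}) =>
    [/\ R' \subset R,
    {in R', forall f : {set T}, exists u a, [/\ u \in U k, a \in A k & f = [set u; a]]} &
    decomposable_into (2 * #|T|) (Ek k :|: R')]).
  move=> k; apply: (close_paths (blk := blk)).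
  - exact: subset_trans (EkE k) (subset_trans (subsetDl _ _) Epot).
  - by move=> f; rewrite !inE => /andP[/andP[_ /famP fU] /eqP <-].
  - exact: UA.
  - by move=> u w b /(hub k b)[a [ak ab Ru Rw]]; exists a; rewrite inE ak.
pose G k := Ek k :|: R' k.
have R'R k : R' k \subset R by have [] := R'P k.
have Edec : E = \bigcup_(k in [set: 'I_7]) G k :|: (R :\: \bigcup_(k in [set: 'I_7]) R' k).
  apply/setP => f; rewrite !inE; apply/idP/idP.
    move=> fE; have [fR|fR] := boolP (f \in R).
      rewrite andbT; case: (boolP (f \in \bigcup_(k in [set: 'I_7]) R' k)) => fR'; last by rewrite orbT.
      case/bigcupP: fR' => k _ fk; rewrite orbF; apply/bigcupP; exists k; rewrite ?inE //.
      by rewrite fk orbT.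
    rewrite andbF orbF; apply/bigcupP; exists (fam f) => //.
    by rewrite !inE fE fR eqxx.
  case/orP => [/bigcupP[k _]|/andP[_ /(subsetP RE)//]].
  rewrite inE => /orP[/(subsetP (EkE k))|/(subsetP (R'R k))/(subsetP RE) //].
  by rewrite inE => /andP[].
rewrite Edec; apply: decomposableU.
- apply/pred0P => f /=; apply/negP => /andP[/bigcupP[k _]]; rewrite !inE.
  move=> fG /andP[/negP fR' fR]; move: fG; rewrite fR /= => fk.
  by apply: fR'; apply/bigcupP; exists k; rewrite ?inE.
- have -> : 14 * #|T| = #|[set: 'I_7]| * (2 * #|T|) by rewrite cardsT card_ord mulnA.
  apply: decomposable_bigcup; first by move=> k _; have [] := R'P k.
  move=> k l _ _ kl; apply/pred0P => f /=; apply/negP; rewrite !inE => /andP[].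
  case: (boolP (f \in R)) => fR /=.
    move=> fk fl; have [_ /(_ f fk)[u [a [uU aA fE]]] _] := R'P k.
    have [_ /(_ f fl)[u' [a' [uU' aA' fE']]] _] := R'P l.
    move: uU aA uU' aA'; rewrite !inE => uk /eqP ak ul /eqP al.
    have : a \in [set u'; a'] by rewrite -fE' fE set22.
    have : u \in [set u'; a'] by rewrite -fE' fE set21.
    rewrite !inE => /orP[/eqP uu'|/eqP ua'] /orP[/eqP au'|/eqP aa'].
    + have := card_edge Epot (subsetP RE f fR).
      by rewrite fE uu' au' setUid cards1.
    + by case/negP: kl; rewrite -ak -al aa'.
    + have := on_line_asym uk; rewrite ua' al => /negP; apply.
      by rewrite -ak au'.
    + by case/negP: kl; rewrite -ak -al aa'.
  have notR' j : f \in R' j = false by apply: contraNF fR; exact: subsetP (R'R j) f.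
  rewrite !notR' !orbF => /andP[_ /eqP fk] /andP[_ /eqP fl].
  by case/negP: kl; rewrite -fk -fl.
- by apply: decR; exact: subsetDl.
Qed.

(** * Numerical estimates *)

(** The integer g is the scale in which all parameters are expressed: the
    reserve has density 1 / (4 g^2), and M = g. *)
Lemma eighth_root n : exists g, g ^ 8 <= n < g.+1 ^ 8.
Proof.
elim: n => [|n [g /andP[le_n lt_n]]]; first by exists 0.
have [le_g|lt_g] := leqP (g.+1 ^ 8) n.+1; last by exists g; rewrite (leq_trans le_n) ?leqnSn.
exists g.+1; rewrite le_g /=; apply: leq_ltn_trans lt_n _.
by rewrite ltn_exp2r.
Qed.

(** The divisor 264 = 24 * 11 comes from the hypothesis 24 K i <= M of
    locally_sparse_decomposition with K = 11. *)
Lemma power_lt_exponential : exists G, forall g, G <= g -> g ^ 9 <= 2 ^ (g %/ 264).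
Proof.
suff [c cP] : exists c, forall g, exists t, g < c * t.+1 /\ t * 10 <= g %/ 264.
  exists (c ^ 10) => g leG; have [t [lt_g le_t]] := cP g.
  have ltc : c ^ 9 <= t.+1.
    have [c0|c_gt0] := posnP c; first by rewrite c0.
    rewrite -(leq_pmul2l c_gt0) -expnS; exact: leq_trans leG (ltnW lt_g).
  apply: (@leq_trans (c ^ 9 * t.+1 ^ 9)).
    by rewrite -expnMn leq_exp2r // ltnW.
  apply: (@leq_trans (t.+1 ^ 10)); first by rewrite [t.+1 ^ 10]expnS leq_mul2r ltc orbT.
  apply: (@leq_trans ((2 ^ t) ^ 10)); first by rewrite leq_exp2r // ltn_expl.
  by rewrite -expnM leq_exp2l.
exists (264 * 10) => g; exists (g %/ 264 %/ 10).
by have := ltn_ceil g (isT : 0 < 264); have := ltn_ceil (g %/ 264) (isT : 0 < 10); clear; lia.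
Qed.

Lemma ffact_leq_exp m k : m ^_ k <= m ^ k.
Proof. by elim: k => // k IHk; rewrite ffactnSr expnSr leq_mul // leq_subr. Qed.

Lemma exp_leq_ffact q k : k <= q -> q ^ k <= (2 * q) ^_ k.
Proof.
elim: k => // k IHk ltk; rewrite ffactnSr expnSr leq_mul ?IHk 1?ltnW //.
by move: ltk; clear; lia.
Qed.

Lemma bin_leq_exp2 m k : 'C(m, k) <= 2 ^ m.
Proof.
elim: m k => [|m IHm] [|k] //; first by rewrite bin0 expn_gt0.
by rewrite binS expnS mul2n -addnn leq_add.
Qed.

(** From q^q <= (2 q) (2 q - 1) ... (q + 1) = q! C(2 q, q) <= q! 4^q. *)
Lemma bin_mul_leq M q : 'C(M * q, q) <= (4 * M) ^ q.
Proof.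
rewrite -(leq_pmul2r (fact_gt0 q)) bin_ffact.
apply: leq_trans (ffact_leq_exp _ _) _.
rewrite expnMn [X in _ <= X * _]expnMn [4 ^ q * _]mulnC -mulnA leq_mul2l; apply/orP; right.
apply: leq_trans (exp_leq_ffact (leqnn q)) _; rewrite -bin_ffact leq_mul2r.
by rewrite -(expnM 2 2 q) bin_leq_exp2 orbT.
Qed.

Lemma leq_bin2l k m1 m2 : m1 <= m2 -> 'C(m1, k) <= 'C(m2, k).
Proof.
move=> le_m; rewrite -(subnKC le_m); elim: (m2 - m1) => [|d IHd]; first by rewrite addn0.
by rewrite addnS; case: k IHd => [|k] IHd; rewrite ?bin0 // binS (leq_trans IHd) ?leq_addr.
Qed.

Definition residue7 (n : nat) (v : 'I_n) : 'I_7 := Ordinal (ltn_pmod v (isT : 0 < 7)).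
Definition residue5 (n : nat) (v : 'I_n) : 'I_5 := Ordinal (ltn_pmod (v %/ 7) (isT : 0 < 5)).

(** The residues modulo 7 are the points of the Fano plane, and residue5 gives
    five candidates within each of them. *)
Definition rich_common_neighbours (n : nat) (E : {set {set 'I_n}}) : Prop :=
  forall k b (u w : 'I_n), u != w -> exists a : 'I_n,
    [/\ residue7 a = k, residue5 a = b, [set u; a] \in E & [set w; a] \in E].

Lemma card_residue_class (n : nat) k b :
  n %/ 35 <= #|[set v : 'I_n | (residue7 v == k) && (residue5 v == b)]|.
Proof.
have lt_n (i : 'I_(n %/ 35)) : i * 35 + b * 7 + k < n.
  have := ltn_ord i; have := ltn_ord b; have := ltn_ord k.
  by have := leq_trunc_div n 35; clear; nia.
pose f (i : 'I_(n %/ 35)) := Ordinal (lt_n i).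
have f_inj : injective f by move=> i j [] eq_ij; apply/val_inj => /=; move: eq_ij; clear; lia.
rewrite -[n %/ 35]card_ord -(card_imset _ f_inj); apply: subset_leq_card.
apply/subsetP => _ /imsetP[i _ ->]; rewrite inE -!val_eqE /=.
have := ltn_ord b; have := ltn_ord k; clear; set b' := nat_of_ord b; set k' := nat_of_ord k.
set i' := nat_of_ord i => ltk ltb.
have -> : i' * 35 + b' * 7 + k' = (i' * 5 + b') * 7 + k' by lia.
rewrite modnMDl divnMDl // (modn_small ltk) (divn_small ltk) addn0 modnMDl.
by rewrite modn_small // !eqxx.
Qed.

Import Order.TTheory GRing.Theory Num.Theory.
Import numFieldNormedType.Exports.

Local Open Scope ring_scope.

Lemma exprD1_le (R : realFieldType) (y : R) n : 0 <= y -> 2 * n%:R * y <= 1 ->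
  (1 + y) ^+ n <= 1 + 2 * n%:R * y.
Proof.
move=> y0; elim: n => [|n IHn]; first by rewrite expr0 mulr0 mul0r addr0.
rewrite -natr1 => le1; have n0 : 0 <= n%:R :> R by rewrite ler0n.
have le1' : 2 * n%:R * y <= 1 by apply: le_trans le1; nra.
rewrite exprSr; apply: le_trans (ler_wpM2r _ (IHn le1')) _; first by rewrite addr_ge0.
by nra.
Qed.

(** By the Bernoulli inequality and (1 - x) (1 + x) <= 1. This turns the
    exponentially small failure probability into an arbitrary negative power
    of the number of vertices. *)
Lemma exprB1_le (R : realFieldType) (x : R) m j t : 0 <= x <= 1 -> (j * t <= m)%N ->
  (1 - x) ^+ m * (t%:R * x) ^+ j <= 1.
Proof.
move=> /andP[x0 x1] le_m.
have bernoulli : t%:R * x <= (1 + x) ^+ t.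
  apply: (@le_trans _ _ (1 + t%:R * x)); first by rewrite lerDr.
  elim: t {le_m} => [|t IHt]; first by rewrite mul0r addr0 expr0.
  rewrite exprSr -natr1; apply: le_trans (ler_wpM2r _ IHt); last by rewrite addr_ge0.
  have : 0 <= t%:R * x * x by rewrite !mulr_ge0 ?ler0n.
  by clear; nra.
have tx0 : 0 <= t%:R * x by rewrite mulr_ge0 ?ler0n.
have x1' : 0 <= 1 - x by rewrite subr_ge0.
apply: (@le_trans _ _ ((1 - x) ^+ (t * j) * ((1 + x) ^+ t) ^+ j)).
  apply: ler_pM; rewrite ?exprn_ge0 //; last first.
    by apply: lerXn2r; rewrite ?nnegrE ?exprn_ge0 ?addr_ge0.
  by apply: ler_wiXn2l => //; [rewrite gerBl | rewrite mulnC].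
rewrite -exprM -exprMn; apply: exprn_ile1; last by nra.
by rewrite mulr_ge0 // addr_ge0.
Qed.

(** * Probabilities in the binomial random graph *)

Section RandomGraph.

Variables (R : realType) (n : nat).
Implicit Types (p q : R) (E S : {set {set 'I_n}}) (A B : {set {set 'I_n}} -> Prop).

Local Notation Om := (potential_edges 'I_n).

(** Expanding a product of sums over the edges; all exact computations with
    the random graph are instances of this. *)
Lemma sum_simple_graphs (a b : {set 'I_n} -> R) :
  \sum_(E in simple_graphs 'I_n) \prod_(e in Om) (if e \in E then a e else b e) =
  \prod_(e in Om) (a e + b e).
Proof.
pose F e := if e \in Om then a e else 0; pose G e := if e \in Om then b e else 1.
transitivity (\prod_e (F e + G e)); last first.
  rewrite [RHS]big_mkcond; apply: eq_bigr => e _; rewrite /F /G.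
  by case: ifP; rewrite ?add0r.
rewrite bigA_distr [RHS](bigID (fun E => E \in simple_graphs 'I_n)) /= [X in _ + X]big1 ?addr0.
  apply: eq_big => [E|E]; first by rewrite inE.
  rewrite inE => EOm; rewrite [LHS]big_mkcond; apply: eq_bigr => e _.
  rewrite /F /G; case: ifP => eOm; last by rewrite (contraFF (subsetP EOm e)).
  by [].
move=> E; rewrite inE => /subsetPn[e eE eOm].
by rewrite (bigD1 e) //= eE /F (negbTE eOm) mul0r.
Qed.

Lemma gnp_probE p A :
  gnp_prob p A = \sum_(E in simple_graphs 'I_n) (`[< A E >])%:R * gnp_weight p E.
Proof.
rewrite /gnp_prob big_mkcondr; apply: eq_bigr => E _.
by case: ifP; rewrite ?mul1r ?mul0r.
Qed.

Lemma gnp_weight_ge0 p E : 0 <= p <= 1 -> 0 <= gnp_weight p E.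
Proof.
move=> /andP[p0 p1]; apply: prodr_ge0 => e _.
by case: ifP; rewrite ?subr_ge0.
Qed.

Lemma gnp_prob_le p A B : 0 <= p <= 1 ->
  (forall E, E \subset Om -> A E -> B E) -> gnp_prob p A <= gnp_prob p B.
Proof.
move=> p01 AB; rewrite !gnp_probE; apply: ler_sum => E; rewrite inE => EOm.
rewrite ler_wpM2r ?gnp_weight_ge0 // ler_nat.
case: asboolP => // AE; case: asboolP => // nB.
by case: nB; exact: AB.
Qed.

Lemma gnp_probT p : gnp_prob p (fun E => True) = 1.
Proof.
rewrite gnp_probE (eq_bigr (fun E => gnp_weight p E)); last first.
  by move=> E _; rewrite asboolT // mul1r.
rewrite /gnp_weight (sum_simple_graphs (fun=> p) (fun=> 1 - p)).
by rewrite big1 // => e _; rewrite addrC subrK.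
Qed.

Lemma gnp_prob_not p A : gnp_prob p A = 1 - gnp_prob p (fun E => ~ A E).
Proof.
rewrite -(gnp_probT p) !gnp_probE -sumrB; apply: eq_bigr => E _.
rewrite -mulrBl; congr (_ * _); rewrite (asboolT (P := True)) //.
by case: (asboolP (A E)) => AE; [rewrite asboolF ?subr0 // => nA|rewrite asboolT // subrr].
Qed.

Lemma gnp_prob_union p (I : finType) (P : pred I) (As : I -> {set {set 'I_n}} -> Prop) A :
  0 <= p <= 1 -> (forall E, E \subset Om -> A E -> exists2 i, P i & As i E) ->
  gnp_prob p A <= \sum_(i | P i) gnp_prob p (As i).
Proof.
move=> p01 cover; rewrite gnp_probE; under [leRHS]eq_bigr do rewrite gnp_probE.
rewrite exchange_big; apply: ler_sum => E; rewrite inE => EOm.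
rewrite -mulr_suml ler_wpM2r ?gnp_weight_ge0 //.
case: asboolP => AE; last by apply: sumr_ge0 => i _; rewrite ler0n.
have [i Pi AiE] := cover E EOm AE.
rewrite (bigD1 i) //= asboolT // lerDl; apply: sumr_ge0 => j _; exact: ler0n.
Qed.

Lemma gnp_prob_cylinder p (S1 S2 : {set {set 'I_n}}) : 0 <= p <= 1 ->
  S1 \subset Om -> S2 \subset Om -> [disjoint S1 & S2] ->
  gnp_prob p (fun E => S1 \subset E /\ [disjoint S2 & E]) = p ^+ #|S1| * (1 - p) ^+ #|S2|.
Proof.
move=> p01 S1Om S2Om dis.
pose a e := if e \in S2 then 0 else p; pose b e := if e \in S1 then 0 else 1 - p.
transitivity (\prod_(e in Om) (a e + b e)).
  rewrite -sum_simple_graphs gnp_probE; apply: eq_bigr => E; rewrite inE => EOm.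
  case: asboolP => [[S1E S2E]|nE].
    rewrite mul1r; apply: eq_bigr => e _; rewrite /a /b.
    case: ifP => eE; first by rewrite (disjointFl S2E).
    by rewrite (contraFF (subsetP S1E e)).
  have [S1E|/subsetPn[e e1 eE]] := boolP (S1 \subset E).
    have [S2E|] := boolP [disjoint S2 & E]; first by case: nE.
    rewrite disjoints_subset => /subsetPn[e e2]; rewrite inE negbK => eE.
    by rewrite mul0r (bigD1 e) ?(subsetP S2Om) //= eE /a e2 mul0r.
  by rewrite mul0r (bigD1 e) ?(subsetP S1Om) //= (negbTE eE) /b e1 mul0r.
rewrite (eq_bigr (fun e => (if e \in S1 then p else 1) * (if e \in S2 then 1 - p else 1))); last first.
  move=> e _; rewrite /a /b; case: (boolP (e \in S1)) => e1.
    by rewrite (disjointFr dis e1) addr0 mulr1.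
  by case: ifP; rewrite ?add0r ?mul1r // addrC subrK.
rewrite big_split /= -!big_mkcondr /=; congr (_ * _); rewrite prodr_const.
  congr (_ ^+ _); apply: eq_card => e; rewrite unfold_in /=.
  by apply/andP/idP => [[]//|e1]; rewrite (subsetP S1Om).
congr (_ ^+ _); apply: eq_card => e; rewrite unfold_in /=.
by apply/andP/idP => [[]//|e1]; rewrite (subsetP S2Om).
Qed.

(** Keeping every edge of G(n, p) independently with probability q / p yields
    G(n, q). *)
Lemma gnp_prob_thin p q A : 0 <= p <= 1 -> 0 <= q <= p ->
  gnp_prob q A <= gnp_prob p (fun E => exists2 S : {set {set 'I_n}}, S \subset E & A S).
Proof.
move=> p01 /andP[q0 qp]; pose t := q / p.
have /andP[p0 p1] := p01.
have pt : p * t = q.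
  have [p_eq0|pN0] := eqVneq p 0; last by rewrite /t mulrCA divff ?mulr1.
  by rewrite p_eq0 mul0r; apply/eqP; rewrite eq_le q0 -p_eq0 qp.
have t0 : 0 <= t by rewrite divr_ge0.
have t1 : t <= 1.
  have [p_eq0|pN0] := eqVneq p 0; first by rewrite /t p_eq0 invr0 mulr0 ler01.
  by rewrite /t ler_pdivrMr ?mul1r // lt_neqAle eq_sym pN0.
pose k E S := \prod_(e in Om) (if e \in S then (if e \in E then t else 0)
                               else (if e \in E then 1 - t else 1)).
have k_ge0 E S : 0 <= k E S.
  by apply: prodr_ge0 => e _; do 2 case: ifP => _ //; rewrite subr_ge0.
have k_sum E : \sum_(S in simple_graphs 'I_n) k E S = 1.
  rewrite sum_simple_graphs big1 // => e _.
  by case: ifP; rewrite ?add0r // addrC subrK.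
have k_sub E S : S \subset Om -> ~~ (S \subset E) -> k E S = 0.
  move=> SOm /subsetPn[e eS eE]; rewrite /k (bigD1 e) ?(subsetP SOm) //=.
  by rewrite eS (negbTE eE) mul0r.
have weightE S : gnp_weight q S = \sum_(E in simple_graphs 'I_n) gnp_weight p E * k E S.
  pose a e := p * (if e \in S then t else 1 - t).
  pose b e := (1 - p) * (if e \in S then 0 else 1).
  transitivity (\prod_(e in Om) (a e + b e)).
    apply: eq_bigr => e _; rewrite /a /b; case: ifP => _; first by rewrite mulr0 addr0.
    by rewrite mulr1 mulrBr mulr1 pt; ring.
  rewrite -sum_simple_graphs; apply: eq_bigr => E _; rewrite -big_split /=.
  by apply: eq_bigr => e _; rewrite /a /b; do 2 case: ifP.
rewrite !gnp_probE; under eq_bigr do rewrite weightE mulr_sumr.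
rewrite exchange_big; apply: ler_sum => E _.
rewrite (eq_bigr (fun S => gnp_weight p E * ((`[< A S >])%:R * k E S))); last first.
  by move=> S _; rewrite mulrCA.
rewrite -mulr_sumr mulrC ler_wpM2r ?gnp_weight_ge0 //.
case: asboolP => [_|nA].
  apply: (@le_trans _ _ (\sum_(S in simple_graphs 'I_n) k E S)); last by rewrite k_sum.
  by apply: ler_sum => S _; case: asboolP => _; rewrite ?mul1r ?mul0r.
rewrite big1 // => S; rewrite inE => SOm; case: asboolP => AS; last by rewrite mul0r.
rewrite k_sub ?mulr0 //; apply/negP => SE; apply: nA; by exists S.
Qed.

End RandomGraph.

(** * Local sparsity and common neighbours of G(n, p) *)

Section RandomGraphProperties.

Variables (R : realType) (n : nat).
Implicit Types (p : R) (E : {set {set 'I_n}}).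

Local Notation Om := (potential_edges 'I_n).

Lemma gnp_prob_superset p (T : {set {set 'I_n}}) : 0 <= p <= 1 -> T \subset Om ->
  gnp_prob p (fun E => T \subset E) <= p ^+ #|T|.
Proof.
move=> p01 TOm; have := @gnp_prob_cylinder R n p T set0 p01 TOm (sub0set _).
rewrite cards0 expr0 mulr1 => <-; last by rewrite -setI_eq0 setI0.
by apply: gnp_prob_le => // E _ TE; split=> //; rewrite -setI_eq0 set0I.
Qed.

Lemma card_edges_in_Om (S : {set 'I_n}) : #|edges_in Om S| = 'C(#|S|, 2).
Proof.
rewrite -cards_draws; apply: eq_card => f; rewrite !inE andbC //.
Qed.

Lemma sum_powerset_expr (I : finType) (A : {set I}) (x : R) :
  \sum_(N in powerset A) x ^+ #|N| = (1 + x) ^+ #|A|.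
Proof.
transitivity (\prod_a ((if a \in A then x else 0) + 1)).
  rewrite bigA_distr [RHS](bigID (fun N => N \in powerset A)) /= [X in _ + X]big1 ?addr0.
    apply: eq_big => [N|N]; first by rewrite inE.
    rewrite powersetE => NA; rewrite -prodr_const big_mkcond; apply: eq_bigr => a _.
    by case: ifP => // aN; rewrite (subsetP NA).
  move=> N; rewrite powersetE => /subsetPn[a aN aA].
  by rewrite (bigD1 a) //= aN (negbTE aA) mul0r.
rewrite -prodr_const [RHS]big_mkcond; apply: eq_bigr => a _.
by case: ifP; rewrite ?add0r // addrC.
Qed.

(** A first moment bound. If S violates local sparsity, it contains q edges of
    the random graph, where q is the least integer with
    M q > #|S| (K M + #|S|). Since the number of pairs in S is at most M q,
    these q edges can be chosen in at most (4 M)^q ways, and q >= K #|S|. It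
    remains to sum x^(K #|S|), where x = 4 M p, over the nonempty sets S. *)
Lemma gnp_prob_not_locally_sparse p (K M : nat) : 0 <= p <= 1 -> (0 < M)%N ->
  4 * M%:R * p <= 1 ->
  gnp_prob p (fun E => ~ locally_sparse K M E) <= (1 + (4 * M%:R * p) ^+ K) ^+ n - 1.
Proof.
move=> p01 M_gt0 Mp1; set x := 4 * M%:R * p.
have /andP[p0 p1] := p01.
have x0 : 0 <= x by rewrite !mulr_ge0 ?ler0n.
pose q (S : {set 'I_n}) := ((#|S| * (K * M + #|S|)) %/ M).+1.
have Mq (S : {set 'I_n}) : (#|S| * (K * M + #|S|) < M * q S)%N.
  by rewrite [(M * q S)%N]mulnC -ltn_divLR.
pose bad (S : {set 'I_n}) E := (#|S| * (K * M + #|S|) < M * #|edges_in E S|)%N.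
have bad_prob (S : {set 'I_n}) : S != set0 -> gnp_prob p (bad S) <= x ^+ K ^+ #|S|.
  move=> S0.
  apply: (@le_trans _ _ (\sum_(T in [set T : {set {set 'I_n}} |
      (T \subset edges_in Om S) && (#|T| == q S)]) p ^+ q S)).
    apply: (@le_trans _ _ (\sum_(T in [set T : {set {set 'I_n}} |
        (T \subset edges_in Om S) && (#|T| == q S)]) gnp_prob p (fun E => T \subset E))).
      apply: gnp_prob_union => // E EOm badS.
      have /card_gt0P[T] : (0 < #|[set T : {set {set 'I_n}} |
          (T \subset edges_in E S) && (#|T| == q S)]|)%N.
        by rewrite cards_draws bin_gt0 /q ltn_divLR // [X in (_ < X)%N]mulnC.
      rewrite inE => /andP[TE Tq]; exists T.
        rewrite inE Tq andbT; apply: subset_trans TE _.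
        apply/subsetP => f /setIdP[fE fS]; apply/setIdP; split=> //.
        exact: subsetP EOm f fE.
      by apply: subset_trans TE _; apply/subsetP => f; rewrite inE => /andP[].
    apply: ler_sum => T; rewrite inE => /andP[TS /eqP <-]; apply: gnp_prob_superset => //.
    by apply: subset_trans TS _; apply/subsetP => f; rewrite inE => /andP[].
  rewrite sumr_const cards_draws card_edges_in_Om -mulr_natl.
  apply: (@le_trans _ _ (x ^+ q S)).
    rewrite exprMn ler_wpM2r ?exprn_ge0 // -natrM -natrX ler_nat.
    apply: leq_trans (bin_mul_leq M (q S)); apply: leq_bin2l.
    apply: leq_trans (ltnW (Mq S)); rewrite bin2.
    by clear; nia.
  rewrite -exprM; apply: ler_wiXn2l => //.
  have := Mq S; move: M_gt0; clear; set s := #|S|; nia.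
apply: (@le_trans _ _ (\sum_(S : {set 'I_n} | S != set0) gnp_prob p (bad S))).
  apply: gnp_prob_union => // E EOm nE.
  have [/forallP //|] := boolP [forall S : {set 'I_n},
    (M * #|edges_in E S| <= #|S| * (K * M + #|S|))%N].
  rewrite negb_forall => /existsP[S]; rewrite -ltnNge => badS; exists S => //.
  apply: contraTneq badS => ->; rewrite cards0 mul0n -leqNgt leqn0 muln_eq0 orbC cards_eq0.
  apply/orP; left; apply/eqP/setP => f; rewrite !inE subset0.
  apply/negP => /andP[fE /eqP f0].
  by have := card_edge EOm fE; rewrite f0 cards0.
rewrite -[n in (1 + _) ^+ n]card_ord -cardsT -sum_powerset_expr.
rewrite [X in _ <= X - 1](bigD1 set0) ?powersetE ?sub0set //= cards0 expr0 [leRHS]addrC addKr.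
rewrite [leRHS](eq_bigl (fun S => S != set0)); first exact: ler_sum.
by move=> S; rewrite powersetE subsetT.
Qed.

(** Summing over the set N of neighbours of u in A: the vertices of A outside N
    are not adjacent to u, those in N are not adjacent to w. *)
Lemma gnp_prob_no_common_neighbour p (u w : 'I_n) (A : {set 'I_n}) :
  0 <= p <= 1 -> u != w -> u \notin A -> w \notin A ->
  gnp_prob p (fun E => forall a, a \in A -> ~ ([set u; a] \in E /\ [set w; a] \in E))
    <= (1 - p ^+ 2) ^+ #|A|.
Proof.
move=> p01 uw uA wA; have /andP[p0 p1] := p01.
pose S1 (N : {set 'I_n}) := [set [set u; a] | a in N].
pose S2 (N : {set 'I_n}) := [set [set u; a] | a in A :\: N] :|: [set [set w; a] | a in N].
pose cyl (N : {set 'I_n}) E := S1 N \subset E /\ [disjoint S2 N & E].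
have star_inj (v v' : 'I_n) a a' : v' \notin A -> a \in A -> [set v; a] = [set v'; a'] -> v = v' /\ a = a'.
  move=> v'A aA eqs; have aa' : a = a'.
    have := set22 v a; rewrite eqs !inE => /orP[/eqP av'|/eqP //].
    by rewrite -av' aA in v'A.
  split=> //; apply: (@set2_inj _ a).
  by rewrite setUC eqs -aa' setUC.
have star_Om (v : 'I_n) (N : {set 'I_n}) : N \subset A -> v \notin A ->
    [set [set v; a] | a in N] \subset Om.
  move=> NA vA; apply/subsetP => _ /imsetP[a aN ->]; rewrite potential_edge_neq.
  by apply: contraNneq vA => ->; exact: subsetP NA _ aN.
apply: (@le_trans _ _ (\sum_(N in powerset A) gnp_prob p (cyl N))).
  apply: gnp_prob_union => // E EOm none.
  exists [set a in A | [set u; a] \in E]; first by rewrite powersetE; apply/subsetP => a; rewrite inE => /andP[].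
  split; first by apply/subsetP => f /imsetP[a /setIdP[_ ua] ->].
  apply/pred0P => f /=; apply/negP => /andP[].
  rewrite inE => /orP[|] /imsetP[a aN fE] fInE; rewrite {}fE in fInE; move: aN.
    by rewrite !inE fInE andbT => /andP[/negP].
  by rewrite inE => /andP[aA ua]; exact: (none a aA).
apply: (@le_trans _ _ (\sum_(N in powerset A) p ^+ #|N| * (1 - p) ^+ #|A|)).
  apply: ler_sum => N; rewrite powersetE => NA.
  have DA : A :\: N \subset A by exact: subsetDl.
  have dis12 : [disjoint S1 N & S2 N].
    apply/pred0P => f /=; apply/negP => /andP[/imsetP[a aN ->]].
    rewrite inE => /orP[|] /imsetP[b bN] /star_inj.
      case=> // [|_ ab]; first exact: subsetP NA _ aN.
      by move: bN; rewrite -ab inE aN.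
    by case=> // [|uw']; [exact: subsetP NA _ aN | move: uw; rewrite uw' eqxx].
  have dis2 : [disjoint [set [set u; a] | a in A :\: N] & [set [set w; a] | a in N]].
    apply/pred0P => f /=; apply/negP => /andP[/imsetP[a aN ->]] /imsetP[b bN] /star_inj.
    by case=> // [|uw']; [exact: subsetP DA _ aN | move: uw; rewrite uw' eqxx].
  rewrite gnp_prob_cylinder //; last 2 first.
  - exact: star_Om.
  - by rewrite subUset !star_Om.
  rewrite /S1 /S2 cardsU (disjoint_setI0 dis2) cards0 subn0.
  rewrite !(card_imset _ (@set2_inj _ _)) cardsD (setIidPr NA) subnK //.
  exact: subset_leq_card.
rewrite -mulr_suml sum_powerset_expr -exprMn.
by have -> : (1 + p) * (1 - p) = 1 - p ^+ 2 by ring.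
Qed.

End RandomGraphProperties.

Section Thresholds.

Variable R : realType.

Lemma gnp_prob_not_rich (n : nat) (p : R) : 0 <= p <= 1 ->
  gnp_prob p (fun E : {set {set 'I_n}} => ~ rich_common_neighbours E) <=
    35 * n%:R ^+ 2 * (1 - p ^+ 2) ^+ (n %/ 35 - 2).
Proof.
move=> p01; have /andP[p0 p1] := p01.
have y0 : 0 <= 1 - p ^+ 2 by rewrite subr_ge0 exprn_ile1.
have y1 : 1 - p ^+ 2 <= 1 by rewrite gerBl exprn_ge0.
pose A (i : 'I_7 * 'I_5 * ('I_n * 'I_n)) :=
  [set v : 'I_n | (residue7 v == i.1.1) && (residue5 v == i.1.2)] :\: [set i.2.1; i.2.2].
pose none (i : 'I_7 * 'I_5 * ('I_n * 'I_n)) (E : {set {set 'I_n}}) :=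
  forall a, a \in A i -> ~ ([set i.2.1; a] \in E /\ [set i.2.2; a] \in E).
apply: (@le_trans _ _ (\sum_(i | i.2.1 != i.2.2) gnp_prob p (none i))).
  apply: gnp_prob_union => // E EOm nrich; apply: contrapT => nnone.
  apply: nrich => k b u w uw; apply: contrapT => nex.
  apply: nnone; exists (k, b, (u, w)) => //= a; rewrite !inE => /andP[_ /andP[/eqP ak /eqP ab]] [ua wa].
  by apply: nex; exists a.
apply: (@le_trans _ _ (\sum_(i : 'I_7 * 'I_5 * ('I_n * 'I_n) | i.2.1 != i.2.2)
    (1 - p ^+ 2) ^+ (n %/ 35 - 2))).
  apply: ler_sum => -[[k b] [u w]] /= uw.
  apply: le_trans (gnp_prob_no_common_neighbour p01 uw _ _) _.
  - by rewrite !inE eqxx.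
  - by rewrite !inE eqxx orbT.
  apply: ler_wiXn2l => //; rewrite /A /=; apply: leq_trans (leq_sub2r 2 (card_residue_class n k b)) _.
  rewrite cardsD leq_sub2l //; apply: leq_trans (subset_leq_card (subsetIr _ _)) _.
  by rewrite cards2; case: (_ == _).
rewrite sumr_const -[leLHS]mulr_natl ler_wpM2r ?exprn_ge0 //.
rewrite -natrX -natrM ler_nat; apply: leq_trans (max_card _) _.
by rewrite !card_prod !card_ord mulnn.
Qed.

Definition threshold (g : nat) : R := (4 * g%:R ^+ 2)^-1.

Lemma sparse_whp (g n : nat) (p : R) : (2 <= g)%N -> (n <= g ^ 9)%N ->
  0 <= p <= threshold g -> p <= 1 ->
  gnp_prob p (fun E : {set {set 'I_n}} => ~ locally_sparse 11 g E) <= g%:R^-1.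
Proof.
move=> g2 le_n /andP[p0 pth] p1.
have g_gt0 : 0 < g%:R :> R by rewrite ltr0n (leq_trans _ g2).
have gV0 : 0 <= (g%:R : R)^-1 by rewrite invr_ge0 ltW.
have gV2 : 2 * (g%:R : R)^-1 <= 1.
  by rewrite ler_pdivrMr // mul1r (ler_nat R 2 g).
have gp : 4 * g%:R * p <= g%:R^-1.
  apply: le_trans (ler_wpM2l _ pth) _; first by rewrite mulr_ge0 ?ler0n.
  rewrite /threshold le_eqVlt; apply/orP; left; apply/eqP; field.
  by rewrite gt_eqF.
have gp0 : 0 <= 4 * g%:R * p by rewrite !mulr_ge0 ?ler0n.
have y_le : 2 * n%:R * (4 * g%:R * p) ^+ 11 <= g%:R^-1.
  apply: (@le_trans _ _ (2 * (g%:R ^+ 9) * g%:R^-1 ^+ 11)).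
    apply: ler_pM; rewrite ?mulr_ge0 ?ler0n ?exprn_ge0 //; last first.
      by apply: lerXn2r; rewrite ?nnegrE.
    by rewrite ler_wpM2l // -natrX ler_nat.
  have -> : 2 * g%:R ^+ 9 * g%:R^-1 ^+ 11 = 2 * g%:R^-1 * g%:R^-1 :> R.
    by field; rewrite gt_eqF.
  by rewrite ler_piMl.
apply: le_trans (@gnp_prob_not_locally_sparse R n p 11 g _ _ _) _.
- by rewrite p0.
- exact: leq_trans g2.
- by apply: le_trans gp _; apply: le_trans gV2; rewrite ler_peMl // ler1n.
rewrite lerBlDl; apply: le_trans (exprD1_le _ _) _.
- exact: exprn_ge0.
- by apply: le_trans y_le _; apply: le_trans gV2; rewrite ler_peMl // ler1n.
by rewrite lerD2l.
Qed.

End Thresholds.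

(** * Almost sure decomposability *)

Section Conclusion.

Variable R : realType.

Lemma threshold_le1 g : (0 < g)%N -> 0 <= threshold R g <= 1.
Proof.
move=> g_gt0; rewrite /threshold invr_ge0 mulr_ge0 ?ler0n ?exprn_ge0 //=.
by rewrite -natrX -natrM invf_le1 ?ltr0n ?ler1n muln_gt0 expn_gt0 g_gt0.
Qed.

(** The choice j = 10, t = g^7 in exprB1_le bounds the probability for one pair
    by g^(-20), which beats the 35 n^2 <= g^19 choices of pairs and classes. *)
Lemma rich_whp (g n : nat) : (400 <= g)%N -> (g ^ 8 <= n <= g ^ 9)%N ->
  gnp_prob (threshold R g) (fun E : {set {set 'I_n}} => ~ rich_common_neighbours E) <= g%:R^-1.
Proof.
move=> g400 /andP[le_n n_le].
have gN_gt0 : (0 < g)%N by apply: leq_trans g400.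
have g_gt0 : 0 < g%:R :> R by rewrite ltr0n.
have p01 := threshold_le1 gN_gt0; have /andP[p0 p1] := p01.
apply: le_trans (gnp_prob_not_rich n p01) _.
set x := threshold R g ^+ 2; set m := (n %/ 35 - 2)%N.
have x01 : 0 <= x <= 1 by rewrite exprn_ge0 ?exprn_ile1.
have jt_m : (10 * g ^ 7 <= m)%N.
  have : (350 * g ^ 7 + 70 <= n)%N.
    apply: leq_trans le_n; rewrite expnS.
    have : (0 < g ^ 7)%N by rewrite expn_gt0 gN_gt0.
    by move: g400; clear; set h := (g ^ 7)%N; nia.
  by rewrite /m; clear; set h := (g ^ 7)%N; lia.
have := exprB1_le x01 jt_m; set q := (1 - x) ^+ m => q_le.
have q0 : 0 <= q by rewrite exprn_ge0 // subr_ge0; have /andP[] := x01.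
have g_le : g%:R ^+ 2 <= (g ^ 7)%:R * x.
  have -> : (g ^ 7)%:R * x = g%:R ^+ 2 * (g%:R / 16).
    by rewrite natrX /x /threshold; field; rewrite gt_eqF.
  rewrite ler_peMr ?exprn_ge0 // ler_pdivlMr // mul1r (ler_nat R 16 g).
  exact: leq_trans g400.
have q_g20 : q * g%:R ^+ 20 <= 1.
  apply: le_trans q_le; rewrite ler_wpM2l // (exprM _ 2 10).
  by apply: lerXn2r; rewrite ?nnegrE ?exprn_ge0 // (le_trans _ g_le) ?exprn_ge0.
rewrite -[leRHS]mul1r ler_pdivlMr //.
apply: le_trans q_g20; rewrite mulrAC [leRHS]mulrC ler_wpM2r //.
rewrite -!natrX -!natrM ler_nat.
apply: (@leq_trans (g * (g ^ 9) ^ 2 * g)).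
  by rewrite leq_mul2r leq_mul ?leq_exp2r ?orbT // (leq_trans _ g400).
by rewrite -expnM -expnS -expnSr.
Qed.

Lemma sparse_decomposition (g n : nat) (E : {set {set 'I_n}}) :
  (2 <= g)%N -> (g ^ 9 <= 2 ^ (g %/ 264))%N -> (n <= g ^ 9)%N ->
  E \subset potential_edges 'I_n -> locally_sparse 11 g E ->
  forall E' : {set {set 'I_n}}, E' \subset E -> decomposable_into (133 * n) E'.
Proof.
move=> g2 g_exp n_le Epot spE E' subE.
rewrite -[n in (133 * n)%N]card_ord.
apply: (@locally_sparse_decomposition _ E 11 g (g %/ 264)) => //.
  by rewrite mulnC leq_trunc_div.
apply: leq_trans (subset_leq_card Epot) _.
have -> : #|potential_edges 'I_n| = 'C(n, 2) by rewrite -[n in 'C(n, _)]card_ord -card_draws.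
rewrite card_ord bin2.
have := leq_trans n_le g_exp; set h := (2 ^ _)%N; clear; nia.
Qed.

(** 147 = 14 + 133: there are seven families with at most n single edges and n
    cycles each, and 12 * 11 + 1 = 133 for the remainder of the reserve. *)
Lemma decomposable_whp : exists G : nat, forall g, (G <= g)%N ->
  forall n, (g ^ 8 <= n < g.+1 ^ 8)%N -> forall p : R, 0 <= p <= 1 ->
    1 - 2 * g%:R^-1 <=
    gnp_prob p (fun E : {set {set 'I_n}} => decomposable_into (147 * n) E).
Proof.
have [G0 G0P] := power_lt_exponential.
exists (maxn 400 G0) => g; rewrite geq_max => /andP[g400 gG0] n /andP[le_n lt_n] p p01.
have g_exp := G0P g gG0.
have g2 : (2 <= g)%N by apply: leq_trans g400.
have n_le : (n <= g ^ 9)%N.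
  apply: leq_trans (ltnW lt_n) _; apply: (@leq_trans ((2 * g) ^ 8)).
    by rewrite leq_exp2r //; move: g2; clear; lia.
  rewrite expnMn [(g ^ 9)%N]expnS leq_mul2r; apply/orP; right.
  exact: leq_trans g400.
have /andP[p0 p1] := p01.
have gV0 : 0 <= (g%:R : R)^-1 by rewrite invr_ge0 ler0n.
have [p_small|p_large] := leP p (threshold R g).
  apply: (@le_trans _ _ (gnp_prob p (fun E : {set {set 'I_n}} => locally_sparse 11 g E))).
    rewrite gnp_prob_not lerD2l lerN2.
    apply: le_trans (@sparse_whp R g n p g2 n_le _ p1) _; first by rewrite p0.
    by rewrite ler_peMl // ler1n.
  apply: gnp_prob_le => // E Epot spE.
  apply: decomposable_leq (sparse_decomposition g2 g_exp n_le Epot spE (subxx E)).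
  by rewrite leq_mul2r orbT.
have g_gt0 : (0 < g)%N by apply: leq_trans g2.
have t01 := threshold_le1 g_gt0; have /andP[t0 t1] := t01.
pose good (E : {set {set 'I_n}}) := locally_sparse 11 g E /\ rich_common_neighbours E.
have good_whp : 1 - 2 * g%:R^-1 <= gnp_prob (threshold R g) good.
  rewrite gnp_prob_not lerD2l lerN2.
  apply: le_trans (@gnp_prob_union R n _ bool predT (fun b E => if b then ~ locally_sparse 11 g E
    else ~ rich_common_neighbours E) _ t01 _) _.
    move=> E Epot ngood; apply: contrapT => none; apply: ngood; split.
      by apply: contrapT => nsp; apply: none; exists true.
    by apply: contrapT => nrich; apply: none; exists false.
  rewrite big_bool /= mulr_natl mulr2n; apply: lerD.
    by apply: sparse_whp => //; rewrite t0 lexx.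
  by apply: rich_whp; rewrite // le_n.
apply: le_trans good_whp _.
apply: le_trans (@gnp_prob_thin R n p _ good p01 _) _; first by rewrite t0 ltW.
apply: gnp_prob_le => // E Epot [S SE [spS richS]].
have Spot := subset_trans SE Epot.
have -> : (147 * n = 14 * #|'I_n| + 133 * n)%N by rewrite card_ord -mulnDl.
apply: (reservoir_decomposition (R := S) (kc := @residue7 n) (blk := @residue5 n)) => //.
exact: sparse_decomposition g2 g_exp n_le Spot spS.
Qed.

End Conclusion.

Theorem theorem1p3 (R : realType) :
  exists c : R, 0 < c /\
    forall p : nat -> R, (forall n : nat, 0 <= p n <= 1) ->
      asymptotically_almost_surely p
        (fun (n : nat) (E : {set {set 'I_n}}) =>
          exists D : {set {set {set 'I_n}}},
            cycle_edge_decomposition E D /\ #|D|%:R <= c * n%:R).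
Proof.
have [G GP] := decomposable_whp R.
exists 147; split; first by rewrite ltr0n.
move=> p p01; rewrite /asymptotically_almost_surely; apply/cvgrPdist_le => /= eps eps_gt0.
pose g0 := (maxn G (Num.trunc (2 / eps)).+1).
exists (g0 ^ 8)%N => // n /= le_n.
have [g /andP[le_g lt_g]] := eighth_root n.
have g0g : (g0 <= g)%N by rewrite -ltnS -(@ltn_exp2r _ _ 8) // (leq_ltn_trans le_n).
have gG : (G <= g)%N by apply: leq_trans g0g; exact: leq_maxl.
have geps : 2 * g%:R^-1 <= eps.
  have lt_eps : 2 / eps < g%:R.
    apply: (@lt_le_trans _ _ (Num.trunc (2 / eps)).+1%:R).
      by apply: truncnS_gt.
    by rewrite ler_nat (leq_trans _ g0g) // leq_maxr.
  have g_gt0 : 0 < g%:R :> R by apply: le_lt_trans lt_eps; rewrite divr_ge0 // ltW.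
  by rewrite ler_pdivrMr // mulrC -ler_pdivrMr // ltW.
set P := gnp_prob _ _.
have P_le1 : P <= 1 by rewrite -(gnp_probT n (p n)); apply: gnp_prob_le.
rewrite ger0_norm ?subr_ge0 // lerBlDr addrC -lerBlDr.
apply: le_trans (_ : 1 - 2 * g%:R^-1 <= _); first by rewrite lerD2l lerN2.
have le_gn : (g ^ 8 <= n < g.+1 ^ 8)%N by rewrite le_g.
apply: le_trans (GP g gG n le_gn (p n) (p01 n)) _.
apply: gnp_prob_le => // E _ [D ED leD]; exists D; split=> //.
by rewrite -natrM ler_nat.
Qed.
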